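(* Every finite set of squares whose total area is at most $\frac{8}{5}$ can be packed into the unit disk (the closed disk of radius $1$). This is worst-case optimal: for every $A > \frac{8}{5}$ there exists a set of squares with total area $A$ that cannot be packed into the unit disk.
   Context: A packing of a set of squares into a container is a placement of congruent copies of the squares (translations and rotations allowed, not necessarily axis-parallel) inside the container such that the interiors of any two placed squares are disjoint. The squares in the set need not be equal. *)

(* Defs.v *)
From Stdlib Require Import Reals Lra List.
Open Scope R_scope.

(* A placement of a square: center c, rotation angle th.  The placed square of
   side s is the closed set of points p with local coordinates
   (u,v) = rotation by -th of (p - c) satisfying |u|,|v| <= s/2. *)
Record placement := mkPlacement { pc_x : R; pc_y : R; p_angle : R }.

Definition loc_u (P : placement) (x y : R) : R :=
  (x - pc_x P) * cos (p_angle P) + (y - pc_y P) * sin (p_angle P).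
Definition loc_v (P : placement) (x y : R) : R :=
  - (x - pc_x P) * sin (p_angle P) + (y - pc_y P) * cos (p_angle P).

Definition in_square (s : R) (P : placement) (x y : R) : Prop :=
  Rabs (loc_u P x y) <= s / 2 /\ Rabs (loc_v P x y) <= s / 2.

Definition in_square_int (s : R) (P : placement) (x y : R) : Prop :=
  Rabs (loc_u P x y) < s / 2 /\ Rabs (loc_v P x y) < s / 2.

Definition in_unit_disk (x y : R) : Prop := x * x + y * y <= 1.

(* A finite (multi)set of squares is given by the list of their side lengths. *)
Definition total_area (l : list R) : R := fold_right (fun s acc => s * s + acc) 0 l.

Definition packable_in_unit_disk (l : list R) : Prop :=
  exists pl : nat -> placement,
    (forall i, (i < length l)%nat -> forall x y,
        in_square (nth i l 0) (pl i) x y -> in_unit_disk x y) /\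
    (forall i j, (i < length l)%nat -> (j < length l)%nat -> i <> j ->
        ~ (exists x y, in_square_int (nth i l 0) (pl i) x y /\
                       in_square_int (nth j l 0) (pl j) x y)).

(* Main.v *)
(* A square of side s in the unit disk with 5 s^2 > 4 contains the center of the disk in its
   interior, so two of them overlap; this gives the optimality.

   For the packing result, the squares are sorted by decreasing side and packed greedily into
   horizontal rows, from top to bottom, into the part of the disk below a horizontal line.  If the
   first square that does not fit into a row of width w and height h has side z, then the squares
   of this row cover an area of at least h^2 + (w - h - z) z.  Two consequences are combined:
   a potential argument in the spirit of Meir and Moser, which is good for small squares, and a
   dynamic program that tabulates, for every height of the line and every side of the largest
   square on a fine grid, an area that can certainly be packed.

   If the largest square is small, rows starting at a suitable height suffice.  Otherwise
   let a >= b >= c be the sides of the largest squares.  One of the following always works: rows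
   below a square of side a at the top of the disk, with two square pockets beside it for
   squares that remain at the end; rows below a first row formed by a and b; or a and b
   stacked in the middle, which is possible since a^2 + b^2 <= 8/5, with one row to the right of
   the stack and many rows to the left.  A subdivision of the possible (a, b, c) into boxes, on
   each of which one of these is certified by the tables, is checked by computation. *)

Require Import Defs.
From Stdlib Require Import Reals List.
From Stdlib Require Import Lra Lia Psatz Bool ZArith Permutation Sorted.
Import ListNotations.
Open Scope R_scope.

(** * Two squares that are too large *)

(** Let [(u, v)] be the center of the square in its own rotated frame. If [|u| >= s/2], the corner
    on the far side has squared distance at least [s^2 + (s/2)^2 = 5 s^2 / 4 > 1] from the origin;
    likewise for [v]. *)
Lemma square_covers_center (s : R) (P : placement) :
  4 / 5 < s * s -> 0 < s ->
  (forall x y, in_square s P x y -> in_unit_disk x y) -> in_square_int s P 0 0.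
Proof.
  intros Hs Hpos Hin.
  destruct P as [a b th]; unfold in_square, in_square_int, in_unit_disk, loc_u, loc_v in *; simpl in *.
  pose proof (sin2_cos2 th) as Hsc; unfold Rsqr in Hsc.
  set (C := cos th) in *; set (S := sin th) in *.
  assert (Hcorner : forall e f, (e = 1 \/ e = -1) -> (f = 1 \/ f = -1) ->
    (e * s / 2 + (a * C + b * S)) * (e * s / 2 + (a * C + b * S))
    + (f * s / 2 + (- a * S + b * C)) * (f * s / 2 + (- a * S + b * C)) <= 1).
  { intros e f He Hf.
    specialize (Hin (a + (e * s / 2) * C - (f * s / 2) * S) (b + (e * s / 2) * S + (f * s / 2) * C)).
    assert (E1 : (a + e * s / 2 * C - f * s / 2 * S - a) * C + (b + e * s / 2 * S + f * s / 2 * C - b) * S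
                 = e * s / 2 * (S * S + C * C)) by ring.
    assert (E2 : - (a + e * s / 2 * C - f * s / 2 * S - a) * S + (b + e * s / 2 * S + f * s / 2 * C - b) * C
                 = f * s / 2 * (S * S + C * C)) by ring.
    rewrite E1, E2, Hsc, !Rmult_1_r in Hin.
    assert (H : forall g, g = 1 \/ g = -1 -> Rabs (g * s / 2) <= s / 2).
    { intros g [-> | ->]; [rewrite Rabs_right | rewrite Rabs_left]; lra. }
    specialize (Hin (conj (H e He) (H f Hf))).
    assert (E3 : (e * s / 2 + (a * C + b * S)) * (e * s / 2 + (a * C + b * S))
      + (f * s / 2 + (- a * S + b * C)) * (f * s / 2 + (- a * S + b * C))
      = (e * s / 2) * (e * s / 2) + (f * s / 2) * (f * s / 2)
        + 2 * (e * s / 2) * (a * C + b * S) + 2 * (f * s / 2) * (- a * S + b * C)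
        + (a * a + b * b) * (S * S + C * C)) by ring.
    assert (E4 : (a + e * s / 2 * C - f * s / 2 * S) * (a + e * s / 2 * C - f * s / 2 * S) +
      (b + e * s / 2 * S + f * s / 2 * C) * (b + e * s / 2 * S + f * s / 2 * C)
      = ((e * s / 2) * (e * s / 2) + (f * s / 2) * (f * s / 2)) * (S * S + C * C)
        + 2 * (e * s / 2) * (a * C + b * S) + 2 * (f * s / 2) * (- a * S + b * C)
        + (a * a + b * b)) by ring.
    rewrite Hsc in E3, E4; lra. }
  replace ((0 - a) * C + (0 - b) * S) with (- (a * C + b * S)) by ring.
  replace (- (0 - a) * S + (0 - b) * C) with (- (- a * S + b * C)) by ring.
  rewrite !Rabs_Ropp.
  set (u := a * C + b * S) in *; set (v := - a * S + b * C) in *.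
  pose proof (Hcorner 1 1 (or_introl eq_refl) (or_introl eq_refl)).
  pose proof (Hcorner 1 (-1) (or_introl eq_refl) (or_intror eq_refl)).
  pose proof (Hcorner (-1) 1 (or_intror eq_refl) (or_introl eq_refl)).
  pose proof (Hcorner (-1) (-1) (or_intror eq_refl) (or_intror eq_refl)).
  split; apply Rabs_def1; apply Rnot_le_lt; intro; nra.
Qed.

Lemma two_large_squares_not_packable (s : R) :
  0 < s -> 4 / 5 < s * s -> ~ packable_in_unit_disk [s; s].
Proof.
  intros Hpos Hs [pl [Hin Hdis]].
  apply (Hdis 0%nat 1%nat); simpl; try lia.
  exists 0, 0; split; apply square_covers_center; auto; intros x y.
  - apply (Hin 0%nat); simpl; lia.
  - apply (Hin 1%nat); simpl; lia.
Qed.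

(** * Axis-parallel packings *)

(* [sx] and [sy] are the coordinates of the lower left corner. *)
Record square := mkSquare { sx : R; sy : R; side : R }.

Definition region := R -> R -> Prop.

Definition inside (G : region) (q : square) : Prop :=
  forall x y, sx q <= x <= sx q + side q -> sy q <= y <= sy q + side q -> G x y.

Definition apart (q r : square) : Prop :=
  sx q + side q <= sx r \/ sx r + side r <= sx q \/
  sy q + side q <= sy r \/ sy r + side r <= sy q.

(** Stated up to permutation, so that lists may be sorted and split freely. *)
Definition packs (G : region) (l : list R) : Prop :=
  exists qs, Permutation (map side qs) l /\
    Forall (fun q => 0 < side q /\ inside G q) qs /\ ForallOrdPairs apart qs.

Lemma apart_sym q r : apart q r -> apart r q.
Proof. unfold apart; tauto. Qed.

Lemma packs_nil G : packs G [].
Proof. exists []; repeat constructor. Qed.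

Lemma packs_incl (G G' : region) l :
  (forall x y, G x y -> G' x y) -> packs G l -> packs G' l.
Proof.
  intros H (qs & Hp & Hf & Ha); exists qs; repeat split; auto.
  eapply Forall_impl; [|exact Hf]; intros q [? Hq]; split; auto.
  intros x y ? ?; apply H, Hq; auto.
Qed.

Lemma packs_perm G l l' : Permutation l l' -> packs G l -> packs G l'.
Proof.
  intros H (qs & Hp & Hf & Ha); exists qs; repeat split; auto.
  now transitivity l.
Qed.

Lemma ForallOrdPairs_app {A} (P : A -> A -> Prop) l1 l2 :
  ForallOrdPairs P l1 -> ForallOrdPairs P l2 ->
  (forall a b, In a l1 -> In b l2 -> P a b) -> ForallOrdPairs P (l1 ++ l2).
Proof.
  induction 1 as [|a l Ha Hl IH]; intros H2 H; simpl; auto.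
  constructor.
  - apply Forall_app; split; auto.
    apply Forall_forall; intros; apply H; simpl; auto.
  - apply IH; auto; intros; apply H; simpl; auto.
Qed.

Lemma ForallOrdPairs_perm {A} (P : A -> A -> Prop) l l' :
  (forall a b, P a b -> P b a) -> Permutation l l' ->
  ForallOrdPairs P l -> ForallOrdPairs P l'.
Proof.
  intros Hs; induction 1 as [|a l l' Hp IH|a b l|l l' l'' H1 IH1 H2 IH2]; intros H; auto.
  - inversion_clear H; constructor; auto.
    eapply Permutation_Forall; eauto.
  - inversion_clear H as [|? ? Hb Hl]; inversion_clear Hl as [|? ? Ha Hl'].
    inversion_clear Hb; repeat constructor; auto.
Qed.

Lemma ForallOrdPairs_nth {A} (P : A -> A -> Prop) d l :
  (forall a b, P a b -> P b a) -> ForallOrdPairs P l ->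
  forall i j, (i < length l)%nat -> (j < length l)%nat -> i <> j ->
  P (nth i l d) (nth j l d).
Proof.
  intros Hs; induction 1 as [|a l Ha Hl IH]; simpl; [lia|].
  rewrite Forall_forall in Ha.
  intros [|i] [|j] Hi Hj Hij; try lia.
  - apply Ha, nth_In; lia.
  - apply Hs, Ha, nth_In; lia.
  - apply IH; lia.
Qed.

Lemma packs_union (G1 G2 G : region) l1 l2 :
  (forall q r, 0 < side q -> 0 < side r -> inside G1 q -> inside G2 r -> apart q r) ->
  (forall x y, G1 x y -> G x y) -> (forall x y, G2 x y -> G x y) ->
  packs G1 l1 -> packs G2 l2 -> packs G (l1 ++ l2).
Proof.
  intros Hsep H1 H2 P1 P2.
  destruct P1 as (q1 & Hp1 & Hf1 & Ha1); destruct P2 as (q2 & Hp2 & Hf2 & Ha2).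
  rewrite Forall_forall in Hf1, Hf2.
  exists (q1 ++ q2); repeat split.
  - rewrite map_app; now apply Permutation_app.
  - apply Forall_app; split; apply Forall_forall; intros q Hq.
    + destruct (Hf1 q Hq) as [? Hi]; split; auto; intros x y ? ?; apply H1, Hi; auto.
    + destruct (Hf2 q Hq) as [? Hi]; split; auto; intros x y ? ?; apply H2, Hi; auto.
  - apply ForallOrdPairs_app; auto; intros a b Ia Ib.
    destruct (Hf1 a Ia), (Hf2 b Ib); auto.
Qed.

Lemma packs_beside (G1 G2 G : region) c l1 l2 :
  (forall x y, G1 x y -> x <= c) -> (forall x y, G2 x y -> c <= x) ->
  (forall x y, G1 x y -> G x y) -> (forall x y, G2 x y -> G x y) ->
  packs G1 l1 -> packs G2 l2 -> packs G (l1 ++ l2).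
Proof.
  intros Hl Hr; apply packs_union; intros q r Hq Hr' Iq Ir; left.
  apply Rle_trans with c.
  - apply (Hl _ (sy q)), Iq; lra.
  - apply (Hr _ (sy r)), Ir; lra.
Qed.

Lemma packs_above (G1 G2 G : region) c l1 l2 :
  (forall x y, G1 x y -> y <= c) -> (forall x y, G2 x y -> c <= y) ->
  (forall x y, G1 x y -> G x y) -> (forall x y, G2 x y -> G x y) ->
  packs G1 l1 -> packs G2 l2 -> packs G (l1 ++ l2).
Proof.
  intros Hl Hr; apply packs_union; intros q r Hq Hr' Iq Ir; right; right; left.
  apply Rle_trans with c.
  - apply (Hl (sx q)), Iq; lra.
  - apply (Hr (sx r)), Ir; lra.
Qed.

Lemma packs_transpose (G : region) l : packs G l -> packs (fun x y => G y x) l.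
Proof.
  intros (qs & Hp & Hf & Ha).
  exists (map (fun q => mkSquare (sy q) (sx q) (side q)) qs); repeat split.
  - now rewrite map_map.
  - apply Forall_map; eapply Forall_impl; [|exact Hf]; intros q [? Hq]; simpl; split; auto.
    intros x y Hx Hy; simpl in *; now apply Hq.
  - clear - Ha; induction Ha as [|a l Hl Hr IH]; simpl; constructor; auto.
    apply Forall_map; revert Hl; apply Forall_impl; unfold apart; simpl; tauto.
Qed.

Lemma packs_reflect (G : region) l : packs G l -> packs (fun x y => G (- x) y) l.
Proof.
  intros (qs & Hp & Hf & Ha).
  exists (map (fun q => mkSquare (- (sx q + side q)) (sy q) (side q)) qs); repeat split.
  - now rewrite map_map.
  - apply Forall_map; eapply Forall_impl; [|exact Hf]; intros q [? Hq]; simpl; split; auto.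
    intros x y Hx Hy; simpl in *; apply Hq; auto; lra.
  - clear - Ha; induction Ha as [|a l Hl Hr IH]; simpl; constructor; auto.
    apply Forall_map; revert Hl; apply Forall_impl; unfold apart; simpl; intros; lra.
Qed.

Definition box (x0 x1 y0 y1 : R) : region := fun x y => x0 <= x <= x1 /\ y0 <= y <= y1.

Definition sum : list R -> R := fold_right Rplus 0.

Lemma packs_row l : forall x0 x1 y0 y1,
  Forall (fun s => 0 < s <= y1 - y0) l -> sum l <= x1 - x0 -> packs (box x0 x1 y0 y1) l.
Proof.
  induction l as [|s l IH]; intros x0 x1 y0 y1 Hf Hs; [apply packs_nil|].
  inversion_clear Hf as [|? ? Hs0 Hl]; simpl in Hs.
  assert (0 <= sum l).
  { clear - Hl; induction Hl; simpl; lra. }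
  apply (packs_beside (box x0 (x0 + s) y0 y1) (box (x0 + s) x1 y0 y1) _ (x0 + s) [s] l);
    try (unfold box; intros; lra).
  - exists [mkSquare x0 y0 s]; split; [apply Permutation_refl|].
    split; [|repeat constructor].
    constructor; [split; [simpl; lra|] | constructor].
    intros x y; unfold box; simpl; lra.
  - apply IH; auto; lra.
Qed.

Lemma packs_box_single s x0 x1 y0 y1 :
  0 < s -> s <= x1 - x0 -> s <= y1 - y0 -> packs (box x0 x1 y0 y1) [s].
Proof. intros; apply packs_row; simpl; [constructor; [|constructor]|]; lra. Qed.

(** All placements get angle 0. They are indexed by position in [l], so the squares are first
    rearranged into the order of [l]. *)
Lemma packable_of_packs (r : R) l : 0 < r ->
  packs (fun x y => x * x + y * y <= r * r) (map (Rmult r) l) -> packable_in_unit_disk l.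
Proof.
  intros Hr (qs & Hp & Hf & Ha).
  symmetry in Hp; destruct (Permutation_map_inv _ _ Hp) as (qs' & Hm & Hp').
  assert (Hf' := Permutation_Forall Hp' Hf); rewrite Forall_forall in Hf'.
  assert (Ha' := ForallOrdPairs_perm apart _ _ apart_sym Hp' Ha).
  set (d := mkSquare 0 0 0).
  assert (Hlen : length qs' = length l).
  { rewrite <- (length_map side), <- Hm; apply length_map. }
  assert (Hnth : forall i, (i < length l)%nat -> r * nth i l 0 = side (nth i qs' d)).
  { intros i Hi; rewrite <- (map_nth side), <- Hm, <- (map_nth (Rmult r)).
    apply nth_indep; now rewrite length_map. }
  exists (fun i => let q := nth i qs' d in
    mkPlacement ((sx q + side q / 2) / r) ((sy q + side q / 2) / r) 0).
  unfold in_square, in_square_int, in_unit_disk, loc_u, loc_v; simpl.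
  rewrite cos_0, sin_0.
  assert (Hdiv : forall x, x / r * r = x) by (intros; field; lra).
  split.
  - intros i Hi x y; specialize (Hnth i Hi).
    assert (Hq : In (nth i qs' d) qs') by (apply nth_In; lia).
    destruct (Hf' _ Hq) as [Hside Hin].
    set (q := nth i qs' d) in *; set (s := nth i l 0) in *.
    intros [Hx Hy].
    assert (E1 := Hdiv (sx q + side q / 2)); assert (E2 := Hdiv (sy q + side q / 2)).
    set (u := (sx q + side q / 2) / r) in *; set (v := (sy q + side q / 2) / r) in *.
    replace ((x - u) * 1 + (y - v) * 0) with (x - u) in Hx by ring.
    replace (- (x - u) * 0 + (y - v) * 1) with (y - v) in Hy by ring.
    assert (Hx1 := Rle_abs (x - u)); assert (Hx2 := Rle_abs (- (x - u))).
    assert (Hy1 := Rle_abs (y - v)); assert (Hy2 := Rle_abs (- (y - v))).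
    rewrite Rabs_Ropp in Hx2, Hy2.
    assert (H : r * x * (r * x) + r * y * (r * y) <= r * r).
    { apply Hin; split; nra. }
    apply Rmult_le_reg_l with (r * r); nra.
  - intros i j Hi Hj Hij (x & y & [Hx Hy] & [Hx' Hy']).
    assert (Hap : apart (nth i qs' d) (nth j qs' d)).
    { apply ForallOrdPairs_nth; auto using apart_sym; lia. }
    assert (E := Hnth i Hi); assert (E' := Hnth j Hj).
    set (q := nth i qs' d) in *; set (s := nth i l 0) in *.
    set (q' := nth j qs' d) in *; set (s' := nth j l 0) in *.
    assert (E1 := Hdiv (sx q + side q / 2)); assert (E2 := Hdiv (sy q + side q / 2)).
    assert (E3 := Hdiv (sx q' + side q' / 2)); assert (E4 := Hdiv (sy q' + side q' / 2)).
    set (u := (sx q + side q / 2) / r) in *; set (v := (sy q + side q / 2) / r) in *.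
    set (u' := (sx q' + side q' / 2) / r) in *; set (v' := (sy q' + side q' / 2) / r) in *.
    apply Rabs_def2 in Hx, Hy, Hx', Hy'.
    unfold apart in Hap; destruct Hap as [Hap|[Hap|[Hap|Hap]]]; nra.
Qed.

(** * Filling rows greedily *)

Definition descending (l : list R) : Prop :=
  Forall (fun s => 0 < s) l /\ StronglySorted (fun a b => b <= a) l.

Lemma descending_cons h l :
  descending (h :: l) -> 0 < h /\ Forall (fun s => s <= h) l /\ descending l.
Proof.
  intros [Hp Hs]; inversion_clear Hp; inversion_clear Hs; unfold descending; auto.
Qed.

Lemma descending_app l1 l2 : descending (l1 ++ l2) ->
  descending l2 /\ forall a b, In a l1 -> In b l2 -> b <= a.
Proof.
  induction l1 as [|h l1 IH]; simpl; intros H; [tauto|].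
  apply descending_cons in H; destruct H as (_ & Hf & Hd).
  destruct (IH Hd) as [H2 H12]; split; auto.
  intros a b [->|Ha] Hb; auto.
  rewrite Forall_forall in Hf; apply Hf, in_or_app; auto.
Qed.

Lemma descending_app_cons l1 z r : descending (l1 ++ z :: r) ->
  0 < z /\ descending (z :: r) /\ Forall (fun s => z <= s) l1.
Proof.
  intros H; apply descending_app in H; destruct H as [Hz H].
  split; [apply (descending_cons z r Hz)|split; auto].
  apply Forall_forall; intros; apply H; simpl; auto.
Qed.

Lemma sum_app l1 l2 : sum (l1 ++ l2) = sum l1 + sum l2.
Proof. induction l1; simpl; lra. Qed.

Lemma total_area_app l1 l2 : total_area (l1 ++ l2) = total_area l1 + total_area l2.
Proof. induction l1; simpl; lra. Qed.

Lemma total_area_nonneg l : 0 <= total_area l.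
Proof. induction l; simpl; nra. Qed.

Lemma total_area_ge_sum z l :
  0 <= z -> Forall (fun s => z <= s) l -> z * sum l <= total_area l.
Proof. intros Hz; induction 1; simpl; nra. Qed.

Lemma total_area_ge_square z l :
  0 <= z -> Forall (fun s => z <= s) l -> 0 < sum l -> z * z <= total_area l.
Proof.
  intros Hz [|a l' Ha Hl]; simpl; intros; [lra|].
  pose proof (total_area_nonneg l'); nra.
Qed.

Definition container := list R -> Prop.

(** Squares enter the row until one of them, [z], overflows it. The overflow [c < sum l1 + z] is
    what later bounds the area covered by the row from below. *)
Lemma greedy_row (C : container) l c : 0 <= c -> C [] ->
  (forall l1 z r, l = l1 ++ z :: r -> sum l1 <= c -> c < sum l1 + z -> C (z :: r)) ->
  exists l1 l2, l = l1 ++ l2 /\ sum l1 <= c /\ C l2.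
Proof.
  revert c; induction l as [|a l IH]; intros c Hc Hnil H.
  - exists [], []; simpl; auto.
  - destruct (Rle_dec a c) as [Hac|Hac].
    + destruct (IH (c - a)) as (l1 & l2 & -> & Hs & HC); auto; [lra| |].
      * intros l1 z r -> H1 H2; apply (H (a :: l1) z r); simpl; auto; lra.
      * exists (a :: l1), l2; simpl; repeat split; auto; lra.
    + exists [], (a :: l); simpl; repeat split; auto.
      apply (H [] a l); simpl; auto; lra.
Qed.

(* The squares not packed into [G] below height [t] are left to [Q]. *)
Definition below (G : region) (Q : container) (t : R) : container :=
  fun l => exists l1 l2, Permutation l (l1 ++ l2) /\
    packs (fun x y => G x y /\ y <= t) l1 /\ Q l2.

Lemma below_rest G (Q : container) t l : Q l -> below G Q t l.
Proof. exists [], l; repeat split; auto using packs_nil. Qed.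

Lemma below_row (G : region) Q x0 x1 b t t' q r :
  (forall x y, box x0 x1 b t x y -> G x y) -> b <= t -> t' <= b ->
  packs (box x0 x1 b t) q -> below G Q t' r -> below G Q t (q ++ r).
Proof.
  intros HG Hbt Ht' Hq (l1 & l2 & Hp & Hl1 & HQ).
  exists (q ++ l1), l2; repeat split; auto.
  - rewrite <- app_assoc; now apply Permutation_app_head.
  - apply packs_perm with (l1 ++ q); [apply Permutation_app_comm|].
    apply (packs_above (fun x y => G x y /\ y <= t') (box x0 x1 b t) _ b); auto.
    + intros x y [_ H]; lra.
    + unfold box; intros; lra.
    + intros x y [H ?]; split; auto; lra.
    + intros x y H; split; auto; destruct H; lra.
Qed.

(* [Phi b] is a lower bound for the area of [G] below height [b], and [om b] the width of a row with
   bottom [b].  The squares of a row of height [h] cover at least [h^2 + (om - h - z) z] if the next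
   row has height [z]: the term [om z] is charged to the decrease of [Phi] over the next row,
   the terms [h^2 - z^2] telescope, and [h * (t - h - bot)] pays for the losses [h z]. *)
Lemma below_of_potential (G : region) (Q : container) (bot t0 kap hmax : R) (om Phi : R -> R) :
  Q [] ->
  (forall h l, descending (h :: l) -> h <= hmax ->
     total_area (h :: l) < h * h + kap -> Q (h :: l)) ->
  (forall b, b <= bot -> Phi b = 0) ->
  (forall b b', b' <= b -> Phi b <= Phi b' + om b * (b - b')) ->
  (forall t b, bot < b -> b <= t -> t <= t0 ->
     exists x0, forall x y, box x0 (x0 + om b) b t x y -> G x y) ->
  forall h l t, descending (h :: l) -> h <= hmax -> t <= t0 ->
  total_area (h :: l) < h * h + Phi (t - h) - h * Rmax 0 (t - h - bot) + kap ->
  below G Q t (h :: l).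
Proof.
  intros HQ0 HQ Hbot Hsub Hrow h l.
  remember (length l) as n eqn:Hn; assert (Hle : (length l <= n)%nat) by lia; clear Hn.
  revert h l Hle; induction n as [n IH] using lt_wf_ind; intros h l Hn t Hd Hh Ht Ha.
  destruct (descending_cons _ _ Hd) as (Hpos & Hf & Hd').
  set (b := t - h) in *.
  (* The row would reach down to [bot]: [Phi b] vanishes and the whole list goes to [Q]. *)
  destruct (Rle_dec b bot) as [Hb|Hb].
  { apply below_rest, HQ; auto.
    specialize (Hbot b Hb); pose proof (Rmax_l 0 (b - bot)); nra. }
  assert (Hb' : bot < b) by lra; clear Hb.
  rewrite Rmax_right in Ha by lra.
  assert (Hphi : Phi b <= om b * (b - bot)).
  { pose proof (Hsub b bot ltac:(lra)); pose proof (Hbot bot ltac:(lra)); lra. }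
  (* The row is too narrow for [h]: then [Phi b < h * (b - bot)], and again [Q] takes everything. *)
  destruct (Rlt_dec (om b) h) as [Hw|Hw].
  { apply below_rest, HQ; auto; nra. }
  destruct (Hrow t b) as [x0 Hbox]; [lra|unfold b; lra|lra|].
  destruct (greedy_row (below G Q b) l (om b - h)) as (l1 & l2 & -> & Hs & HC).
  - lra.
  - now apply below_rest.
  - intros l1 z r -> Hs1 Hs2.
    destruct (descending_app_cons _ _ _ Hd') as (Hz & Hdz & Hzl).
    assert (Hzh : z <= h).
    { rewrite Forall_forall in Hf; apply Hf, in_or_app; simpl; auto. }
    pose proof (total_area_ge_sum z l1 ltac:(lra) Hzl) as Har.
    change (total_area (h :: l1 ++ z :: r)) with (h * h + total_area (l1 ++ z :: r)) in Ha.
    rewrite total_area_app in Ha.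
    apply (IH (length r)); auto; try lra.
    { rewrite length_app in Hn; simpl in Hn; lia. }
    { unfold b; lra. }
    pose proof (Hsub b (b - z) ltac:(lra)) as Hphi'.
    assert (z * (om b - h - z) <= z * sum l1) by (apply Rmult_le_compat_l; lra).
    (* If the next bottom [b - z] is still above [bot], the claim reduces to
       [(h - z) * (b - bot - z) >= 0]. Otherwise [Phi (b - z) = 0], and the slack is
       [(om b - h) * (z - (b - bot))]. *)
    unfold Rmax; destruct (Rle_dec 0 (b - z - bot)).
    + assert (0 <= (h - z) * (b - bot - z)) by (apply Rmult_le_pos; lra).
      nra.
    + pose proof (Hbot (b - z) ltac:(lra)).
      assert (0 <= (om b - h) * (z - (b - bot))) by (apply Rmult_le_pos; lra).
      nra.
  - rewrite app_comm_cons.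
    apply below_row with x0 (x0 + om b) b b; auto; try (unfold b; lra).
    apply packs_row; [|simpl; lra].
    apply Forall_forall; intros s Hin.
    destruct Hd as [Hp _]; rewrite Forall_forall in Hp, Hf.
    unfold b; split.
    + apply Hp; rewrite app_comm_cons; apply in_or_app; auto.
    + destruct Hin as [->|Hin]; [lra|].
      assert (s <= h) by (apply Hf, in_or_app; auto); lra.
Qed.

(** The theorem of Moon and Moser that half of the area of a square container can be packed, here as
    an instance of the potential argument with constant row width [p] and no reserve. *)
Lemma packs_square_container p x0 y0 l :
  descending l -> Forall (fun s => s <= p) l -> total_area l < p * p / 2 ->
  packs (box x0 (x0 + p) y0 (y0 + p)) l.
Proof.
  destruct l as [|h l]; intros Hd Hf Ha; [apply packs_nil|].
  inversion_clear Hf as [|? ? Hp _]; destruct (descending_cons _ _ Hd) as (Hh & _).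
  destruct (below_of_potential (box x0 (x0 + p) y0 (y0 + p)) (fun l => l = []) y0 (y0 + p) 0 p
    (fun _ => p) (fun b => p * Rmax 0 (b - y0))) with (h := h) (l := l) (t := y0 + p)
    as (l1 & l2 & Hperm & Hl1 & ->); auto; try lra.
  - intros h' l' _ _; simpl; pose proof (total_area_nonneg l'); lra.
  - intros b Hb; rewrite Rmax_left by lra; lra.
  - intros b b' Hb; unfold Rmax; destruct (Rle_dec 0 (b - y0)), (Rle_dec 0 (b' - y0)); nra.
  - intros t b Hb Hbt Ht; exists x0; unfold box; intros; lra.
  (* The bound is [h^2 + (p - h)^2], which is least at [h = p / 2], with value [p^2 / 2]. *)
  - rewrite Rmax_right by lra; pose proof (Rle_0_sqr (h - p / 2)); unfold Rsqr in *; lra.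
  - rewrite app_nil_r in Hperm; symmetry in Hperm; apply (packs_perm _ _ _ Hperm).
    revert Hl1; apply packs_incl; tauto.
Qed.

(** * Tabulated thresholds *)

(* Lengths are measured so that the disk has radius 800; the tables live on the grid of multiples
   of 4, so that integer arguments of tabulated functions are to be multiplied by 4, and tabulated
   areas by 16. *)
Definition disk : region := fun x y => x * x + y * y <= 800 * 800.

Definition chords : list Z := Eval vm_compute in
  map (fun k => Z.sqrt (4 * (200 * 200 - Z.of_nat k * Z.of_nat k))) (seq 0 201).

(** The default -1 marks heights outside the disk: no square fits into a row of negative width. *)
Definition chord (k : Z) : Z := nth (Z.to_nat (Z.abs k)) chords (-1)%Z.

(* Lower Riemann sums for the area of the disk below height [-k]. *)
Definition caps : list Z := Eval vm_compute in
  map (fun k => fold_right Z.add 0%Z (skipn (k + 1) chords)) (seq 0 201).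

Definition cap (k : Z) : Z := nth (Z.to_nat k) caps 0%Z.

(* A reserve of area [gain] for squares of side at most [limit] outside the region
   that is filled by rows. *)
Record reserve := mkReserve { limit : Z; gain : Z }.

Open Scope Z_scope.

Definition bonus (p : reserve) (j : Z) : Z := if j <=? limit p then gain p else 0.

(** A threshold valid for every region. A largest side above [j - 1] already accounts for the first
    summand, so what remains is below the bonus, which the reserve takes; without a bonus no such
    list exists. *)
Definition base (p : reserve) (j : Z) : Z := (j - 1) * (j - 1) + bonus p j.

(* The first square that does not fit into a row has rounded up side [q + 1], and [r] is the
   part of the row that the squares before it cover for certain; [row] is the table of thresholds
   for the region below that row. *)
Fixpoint row_min (p : reserve) (row : list Z) (r q : Z) (k : nat) : Z :=
  match k with
  | O => 100000
  | S k' =>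
    let m := row_min p (tl row) (Z.pred r) (Z.succ q) k' in
    let v := match row with v :: _ => v | [] => base p (q + 1) end in
    if m <=? v then m else if r <? 0 then v else Z.min m (v + q * Z.max q r)
  end.

(** With [z] at most [q + 1], the squares before it fill more than [rest - 1 - q]. The value 100000
    stands for a row that never overflows; it exceeds 64000, which is [8/5 * 200^2]. *)
Definition row_threshold (p : reserve) (row : list Z) (rest jmax : Z) : Z :=
  row_min p row (rest - 1) 0 (Z.to_nat jmax).

(** Above [-c] the slope is frozen at [chord c], since a row with top at [t] may be narrowest at its
    top edge. *)
Definition cap_below (t b : Z) : Z :=
  let c := Z.max t 0 in
  if b <=? - c then cap (- b) else cap c + (b + c) * chord c.

(** The bound of [below_of_potential] with [bot] at the lowest point of the disk; each term is
    rounded to its worst value for a side between [j - 1] and [j]. *)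
Definition smooth (p : reserve) (t j : Z) : Z :=
  if t + 200 <=? j then 0 else
  (j - 1) * (j - 1) + cap_below t (t - j) - j * (200 + t - (j - 1)) + bonus p j.

Definition width (t j : Z) : Z := chord (Z.max (Z.abs t) (Z.abs (t - j))).

Definition rowwise (p : reserve) (row : list Z) (t j : Z) : Z :=
  let W := width t j in
  if W <? j then base p j else (j - 1) * (j - 1) + row_threshold p row (W - j) j.

(** A row of height [j] has its bottom at [t - j]; dropping one element of [rows] whenever [j] grows
    keeps the table for that height at the head. *)
Fixpoint make_row (p : reserve) (t j : Z) (k : nat) (rows : list (list Z)) : list Z :=
  match k with
  | O => []
  | S k' =>
    Z.max (rowwise p (hd [] rows) t j) (smooth p t j) :: make_row p t (j + 1) k' (tl rows)
  end.

Definition row_length (t : Z) : nat := Z.to_nat (if t <? 0 then 146 else 146 - t / 2).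

Fixpoint make_table (p : reserve) (t : Z) (n : nat) (rows : list (list Z)) : list (list Z) :=
  match n with
  | O => rows
  | S n' => make_table p (t + 1) n' (make_row p t 1 (row_length t) rows :: rows)
  end.

(* The rows for [t = 135, 134, ..., -199]. *)
Definition table (p : reserve) : list (list Z) := make_table p (-199) 335 [].

Close Scope Z_scope.

(** * Correctness of the tabulated thresholds *)

Definition good (C : container) (u v a : R) : Prop :=
  forall h l, descending (h :: l) -> u < h <= v -> total_area (h :: l) < a -> C (h :: l).

Definition cell_good (C : container) (j a : Z) : Prop :=
  good C (4 * (IZR j - 1)) (4 * IZR j) (16 * IZR a).

Definition reserve_ok (p : reserve) (Q : container) : Prop :=
  Q [] /\ forall h l, descending (h :: l) -> h <= 4 * IZR (limit p) ->
    total_area (h :: l) < h * h + 16 * IZR (gain p) -> Q (h :: l).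

(** Entries beyond the end of [row] default to [base], which is always valid, so tables may be
    truncated anywhere. *)
Definition row_good (p : reserve) (Q : container) (t : Z) (row : list Z) : Prop :=
  forall i : nat, cell_good (below disk Q (4 * IZR t)) (Z.of_nat i + 1)
    (nth i row (base p (Z.of_nat i + 1))).

Lemma cell_good_max C j a b : cell_good C j a -> cell_good C j b -> cell_good C j (Z.max a b).
Proof. intros; destruct (Z.max_spec a b) as [[_ ->]|[_ ->]]; auto. Qed.

Lemma total_area_cons_ge h l : h * h <= total_area (h :: l).
Proof. simpl; pose proof (total_area_nonneg l); lra. Qed.

Lemma bonus_reserve p Q j : reserve_ok p Q ->
  forall h l, descending (h :: l) -> h <= 4 * IZR j ->
  total_area (h :: l) < h * h + 16 * IZR (bonus p j) -> Q (h :: l).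
Proof.
  intros [_ HQ] h l Hd Hh Ha; unfold bonus in Ha.
  destruct (Z.leb_spec j (limit p)) as [Hj|Hj].
  - apply HQ; auto; apply IZR_le in Hj; lra.
  - pose proof (total_area_cons_ge h l); lra.
Qed.

Lemma base_good p Q t j : reserve_ok p Q -> (1 <= j)%Z ->
  cell_good (below disk Q t) j (base p j).
Proof.
  intros HQ Hj h l Hd Hh Ha; apply below_rest, (bonus_reserve p Q j); auto; [lra|].
  unfold base in Ha; rewrite plus_IZR, mult_IZR, minus_IZR in Ha.
  apply IZR_le in Hj; nra.
Qed.

Lemma exists_cell z : 0 < z -> exists j : nat, 4 * IZR (Z.of_nat j) < z <= 4 * (IZR (Z.of_nat j) + 1).
Proof.
  intros Hz; destruct (archimed (z / 4)) as [H1 H2].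
  assert (Hup : (0 < up (z / 4))%Z) by (apply lt_IZR; lra).
  (* Cells are closed on the right, so an integral [z / 4] belongs to the cell one lower than [up]
     suggests. *)
  destruct (Req_dec (IZR (up (z / 4)) - z / 4) 1) as [E|E].
  - exists (Z.to_nat (up (z / 4) - 2)).
    assert ((1 < up (z / 4))%Z) by (apply lt_IZR; lra).
    rewrite Z2Nat.id, minus_IZR by lia; lra.
  - exists (Z.to_nat (up (z / 4) - 1)).
    rewrite Z2Nat.id, minus_IZR by lia; lra.
Qed.

Lemma row_min_le p k : forall row r q i, (0 <= q)%Z -> (i < k)%nat ->
  let q' := (q + Z.of_nat i)%Z in let r' := (r - Z.of_nat i)%Z in
  (row_min p row r q k <=
   nth i row (base p (q' + 1)) + if r' <? 0 then 0 else q' * Z.max q' r')%Z.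
Proof.
  induction k as [|k IH]; intros row r q i Hq Hi; [lia|].
  cbv zeta; simpl row_min.
  set (m := row_min p (tl row) (Z.pred r) (Z.succ q) k).
  destruct i as [|i].
  - rewrite Z.add_0_r, Z.sub_0_r.
    replace (nth 0 row (base p (q + 1)))
      with (match row with v :: _ => v | [] => base p (q + 1) end) by now destruct row.
    set (v := match row with v :: _ => v | [] => base p (q + 1) end).
    destruct (Z.leb_spec m v), (Z.ltb_spec r 0); nia.
  - specialize (IH (tl row) (Z.pred r) (Z.succ q) i ltac:(lia) ltac:(lia)); cbv zeta in IH.
    fold m in IH.
    replace (Z.succ q + Z.of_nat i)%Z with (q + Z.of_nat (S i))%Z in IH by lia.
    replace (Z.pred r - Z.of_nat i)%Z with (r - Z.of_nat (S i))%Z in IH by lia.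
    set (b := base p (q + Z.of_nat (S i) + 1)) in *.
    replace (nth i (tl row) b) with (nth (S i) row b) in IH by (destruct row; simpl; auto; now destruct i).
    set (v := match row with v :: _ => v | [] => base p (q + 1) end).
    destruct (Z.leb_spec m v), (Z.ltb_spec r 0); lia.
Qed.

Lemma row_min_fill p Q t row rest jm l c : reserve_ok p Q -> row_good p Q t row ->
  descending l -> Forall (fun s => s <= 4 * IZR jm) l -> 0 <= c -> 4 * IZR rest <= c ->
  total_area l < 16 * IZR (row_threshold p row rest jm) ->
  exists l1 l2, l = l1 ++ l2 /\ sum l1 <= c /\ below disk Q (4 * IZR t) l2.
Proof.
  intros HQ Hrow Hd Hf Hc Hr Ha.
  apply greedy_row; auto; [apply below_rest, HQ|].
  intros l1 z r -> Hs1 Hs2.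
  destruct (descending_app_cons _ _ _ Hd) as (Hz & Hdz & Hzl).
  destruct (exists_cell z Hz) as [i Hi].
  assert (Hzj : z <= 4 * IZR jm).
  { rewrite Forall_forall in Hf; apply Hf, in_or_app; simpl; auto. }
  assert (Hij : (i < Z.to_nat jm)%nat).
  { enough (Z.of_nat i < jm)%Z by lia; apply lt_IZR; lra. }
  apply (Hrow i); auto.
  { rewrite plus_IZR; lra. }
  pose proof (row_min_le p (Z.to_nat jm) row (rest - 1) 0 i ltac:(lia) Hij) as Hm; cbv zeta in Hm.
  rewrite Z.add_0_l in Hm; fold (row_threshold p row rest jm) in Hm.
  replace (rest - 1 - Z.of_nat i)%Z with (rest - (Z.of_nat i + 1))%Z in Hm by lia.
  set (v := nth i row (base p (Z.of_nat i + 1))) in *.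
  rewrite total_area_app in Ha.
  apply IZR_le in Hm; rewrite plus_IZR in Hm.
  pose proof (IZR_le _ _ (Zle_0_nat i)) as Hi0.
  destruct (Z.ltb_spec (rest - (Z.of_nat i + 1)) 0) as [Hneg|Hneg].
  - pose proof (total_area_nonneg l1); lra.
  - rewrite mult_IZR in Hm.
    assert (E : IZR (rest - (Z.of_nat i + 1)) = IZR rest - IZR (Z.of_nat i) - 1)
      by (rewrite minus_IZR, plus_IZR; ring).
    apply IZR_le in Hneg; rewrite E in Hneg.
    (* Two bounds for the area of [l1]: [z * sum l1] and, as [l1] is not empty, [z * z]. They match
       the two arguments of [Z.max] in [row_min]. *)
    pose proof (total_area_ge_sum z l1 ltac:(lra) Hzl) as B1.
    pose proof (total_area_ge_square z l1 ltac:(lra) Hzl ltac:(lra)) as B2.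
    destruct (Z.max_spec (Z.of_nat i) (rest - (Z.of_nat i + 1))) as [[_ Emax]|[_ Emax]];
      rewrite Emax in Hm; try rewrite E in Hm; nra.
Qed.

(* The squares in [pre] are placed into the row in any case. *)
Lemma below_fill_row p Q t t' row rest jm pre l v w : reserve_ok p Q -> row_good p Q t' row ->
  (forall x y, box (- w / 2) (w / 2) (t - v) t x y -> disk x y) -> 0 <= v ->
  4 * IZR t' <= t - v ->
  Forall (fun s => 0 < s <= v) (pre ++ l) -> descending l ->
  Forall (fun s => s <= 4 * IZR jm) l -> sum pre <= w -> 4 * IZR rest <= w - sum pre ->
  total_area l < 16 * IZR (row_threshold p row rest jm) ->
  below disk Q t (pre ++ l).
Proof.
  intros HQ Hrow Hbox Hv Ht' Hf Hd Hjm Hpre Hrest Ha.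
  destruct (row_min_fill p Q t' row rest jm l (w - sum pre)) as (l1 & l2 & -> & Hs & HC); auto;
    [lra|].
  rewrite app_assoc in *; apply Forall_app in Hf; destruct Hf as [Hf _].
  apply below_row with (- w / 2) (w / 2) (t - v) (4 * IZR t'); auto; [lra|].
  apply packs_row.
  - revert Hf; apply Forall_impl; intros; lra.
  - rewrite sum_app; lra.
Qed.

Lemma chord_spec k : (0 <= chord k -> chord k * chord k + 4 * (k * k) <= 4 * (200 * 200))%Z.
Proof.
  unfold chord; set (i := Z.to_nat (Z.abs k)).
  change chords with
    (map (fun k => Z.sqrt (4 * (200 * 200 - Z.of_nat k * Z.of_nat k))) (seq 0 201)).
  destruct (Nat.lt_ge_cases i 201) as [Hi|Hi].
  - rewrite (nth_indep _ _ (Z.sqrt (4 * (200 * 200 - Z.of_nat 0 * Z.of_nat 0))))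
      by now rewrite length_map, length_seq.
    rewrite (map_nth (fun k => Z.sqrt (4 * (200 * 200 - Z.of_nat k * Z.of_nat k)))).
    rewrite seq_nth by auto; intros _.
    assert (Hk : (Z.of_nat (0 + i) = Z.abs k)%Z) by lia; rewrite Hk.
    assert (0 <= Z.abs k <= 200)%Z by lia.
    pose proof (Z.sqrt_spec (4 * (200 * 200 - Z.abs k * Z.abs k)) ltac:(nia)) as [Hs _].
    assert (Z.abs k * Z.abs k = k * k)%Z by (rewrite <- Z.abs_mul; apply Z.abs_eq; nia).
    lia.
  - rewrite nth_overflow by now rewrite length_map, length_seq.
    lia.
Qed.

Lemma Z_square_le a b : (Z.abs a <= b -> a * a <= b * b)%Z.
Proof.
  intros H; assert (0 <= (b - a) * (b + a))%Z by (apply Z.mul_nonneg_nonneg; lia); lia.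
Qed.

Lemma box_in_disk w b t : b <= t -> w * w + 4 * (b * b) <= 4 * (800 * 800) ->
  w * w + 4 * (t * t) <= 4 * (800 * 800) ->
  forall x y, box (- w / 2) (w / 2) b t x y -> disk x y.
Proof.
  intros Hbt Hb Ht x y [Hx Hy]; unfold disk.
  assert (0 <= (w / 2 - x) * (w / 2 + x)) by (apply Rmult_le_pos; lra).
  assert (0 <= (t - y) * (y - b)) by (apply Rmult_le_pos; lra).
  destruct (Rle_dec 0 (t + b)).
  - assert (0 <= (t + b) * (t - y)) by (apply Rmult_le_pos; lra).
    nra.
  - assert (0 <= - (t + b) * (y - b)) by (apply Rmult_le_pos; lra).
    nra.
Qed.

(** The row gets height [4 * j] and the chord at its edge farther from the center; the first square
    uses at most [4 * j] of that width. *)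
Lemma rowwise_good p Q t j row : reserve_ok p Q -> (1 <= j)%Z -> row_good p Q (t - j) row ->
  cell_good (below disk Q (4 * IZR t)) j (rowwise p row t j).
Proof.
  intros HQ Hj Hrow; unfold rowwise.
  destruct (Z.ltb_spec (width t j) j) as [HW|HW]; [now apply base_good|].
  intros h l Hd Hh Ha.
  destruct (descending_cons _ _ Hd) as (Hpos & Hf & Hd').
  rewrite plus_IZR, mult_IZR, minus_IZR in Ha.
  change (total_area (h :: l)) with (h * h + total_area l) in Ha.
  unfold width in *; set (m := Z.max (Z.abs t) (Z.abs (t - j))) in *.
  assert (Hmax : (Z.abs t <= m /\ Z.abs (t - j) <= m)%Z) by (unfold m; lia); clearbody m.
  pose proof (chord_spec m ltac:(lia)) as Hm.
  apply (below_fill_row p Q (4 * IZR t) (t - j) row (chord m - j) j [h] l (4 * IZR j)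
    (4 * IZR (chord m))); auto; simpl.
  - assert (Hm1 : (t * t <= m * m)%Z).
    { now apply Z_square_le. }
    assert (Hm2 : ((t - j) * (t - j) <= m * m)%Z).
    { now apply Z_square_le. }
    assert (Hm1' : (chord m * chord m + 4 * (t * t) <= 4 * (200 * 200))%Z) by lia.
    assert (Hm2' : (chord m * chord m + 4 * ((t - j) * (t - j)) <= 4 * (200 * 200))%Z) by lia.
    apply IZR_le in Hm1', Hm2'; rewrite plus_IZR, !mult_IZR in Hm1', Hm2'; rewrite minus_IZR in Hm2'.
    apply IZR_le in Hj.
    apply box_in_disk; lra.
  - apply IZR_le in Hj; lra.
  - rewrite minus_IZR; lra.
  - constructor; [lra|].
    destruct Hd' as [Hp' _]; rewrite Forall_forall in *; intros s Hs.
    specialize (Hp' s Hs); specialize (Hf s Hs); lra.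
  - revert Hf; apply Forall_impl; intros; lra.
  - apply IZR_le in HW; lra.
  - rewrite minus_IZR; lra.
  - apply IZR_le in Hj; nra.
Qed.

(* [Phi n] is a convex piecewise linear lower bound for the area of the disk below a given height,
   with slope [om n] equal to the tabulated chord at the next lower grid point; above
   [4 * (n - 200)] it is linear. *)
Fixpoint Phi (n : nat) (b : R) : R :=
  match n with
  | O => 0
  | S n' =>
    let k := (199 - Z.of_nat n')%Z in
    Phi n' b + 4 * IZR (chord k - chord (k + 1)) * Rmax 0 (b + 4 * IZR k)
  end.

Fixpoint om (n : nat) (b : R) : R :=
  match n with
  | O => 0
  | S n' =>
    let k := (199 - Z.of_nat n')%Z in
    if Rlt_dec (- 4 * IZR k) b then 4 * IZR (chord k) else om n' b
  end.

Lemma forall_of_forallb (f : Z -> bool) n : forallb (fun i => f (Z.of_nat i)) (seq 0 n) = true ->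
  forall k, (0 <= k < Z.of_nat n)%Z -> f k = true.
Proof.
  intros H k Hk; rewrite forallb_forall in H.
  rewrite <- (Z2Nat.id k) by lia; apply H, in_seq; lia.
Qed.

Lemma chord_decreasing k : (0 <= k < 200)%Z -> (0 <= chord (k + 1) <= chord k)%Z.
Proof.
  intros Hk.
  pose proof (forall_of_forallb (fun k => andb (0 <=? chord (k + 1)) (chord (k + 1) <=? chord k))%Z
    200 eq_refl k Hk) as H.
  apply andb_prop in H; lia.
Qed.

Lemma cap_step k : (0 <= k < 200)%Z -> cap k = (chord (k + 1) + cap (k + 1))%Z.
Proof.
  intros Hk.
  apply Z.eqb_eq.
  exact (forall_of_forallb (fun k => cap k =? chord (k + 1) + cap (k + 1))%Z 200 eq_refl k Hk).
Qed.

Lemma Phi_below n b : (n <= 200)%nat -> b <= -800 -> Phi n b = 0.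
Proof.
  intros Hn Hb; induction n as [|n IH]; cbn [Phi]; auto.
  rewrite IH by lia; pose proof (IZR_le _ _ (Zle_0_nat n)).
  rewrite Rmax_left by (rewrite minus_IZR; lra); lra.
Qed.

Lemma om_above n b : (n <= 200)%nat -> -800 < b -> 4 * IZR (Z.of_nat n) - 800 < b ->
  om n b = 4 * IZR (chord (200 - Z.of_nat n)).
Proof.
  intros Hn Hb Hnb; destruct n as [|n]; cbn [om].
  - simpl in Hnb. change (chord (200 - Z.of_nat 0)) with 0%Z; lra.
  - rewrite Nat2Z.inj_succ in *; unfold Z.succ in *; rewrite plus_IZR in Hnb.
    rewrite minus_IZR; destruct (Rlt_dec _ _) as [H|H]; [|lra].
    do 3 f_equal; lia.
Qed.

Lemma om_succ n b : b <= 4 * IZR (Z.of_nat n + 1) - 800 -> om (S n) b = om n b.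
Proof.
  intros H; cbn [om]; rewrite minus_IZR; rewrite plus_IZR in H.
  destruct (Rlt_dec _ _); lra.
Qed.

(** [om n b] is the left slope of the convex function [Phi n] at [b]. The induction adds one kink at
    a time. *)
Lemma Phi_subgradient n : (n <= 200)%nat -> forall b b', b' <= b ->
  Phi n b <= Phi n b' + om n b * (b - b').
Proof.
  induction n as [|n IH]; intros Hn b b' Hb; [simpl; lra|].
  destruct (Rle_dec b (4 * IZR (Z.of_nat n + 1) - 800)) as [H|H].
  - rewrite om_succ by auto; cbn [Phi]; specialize (IH ltac:(lia) b b' Hb).
    rewrite minus_IZR with (n := 199%Z); rewrite plus_IZR in H.
    rewrite (Rmax_left 0 (b + _)), (Rmax_left 0 (b' + _)) by lra; lra.
  - pose proof (IZR_le _ _ (Zle_0_nat n)) as Hn0.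
    assert (Hom : om n b <= 4 * IZR (chord (199 - Z.of_nat n + 1))).
    { rewrite plus_IZR in H.
      rewrite om_above by (lia || lra).
      replace (199 - Z.of_nat n + 1)%Z with (200 - Z.of_nat n)%Z by lia; lra. }
    assert (Hom' : om (S n) b = 4 * IZR (chord (199 - Z.of_nat n))).
    { cbn [om]; rewrite minus_IZR; rewrite plus_IZR in H; destruct (Rlt_dec _ _); lra. }
    rewrite Hom'; cbn [Phi]; specialize (IH ltac:(lia) b b' Hb).
    pose proof (chord_decreasing (199 - Z.of_nat n) ltac:(lia)) as [_ Hc]; apply IZR_le in Hc.
    rewrite !minus_IZR in *; rewrite plus_IZR in *.
    set (c := IZR (chord (199 - Z.of_nat n))) in *.
    set (c' := IZR (chord (199 - Z.of_nat n + 1))) in *.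
    set (y := 4 * (199 - IZR (Z.of_nat n))) in *.
    assert (Rmax 0 (b + y) <= Rmax 0 (b' + y) + (b - b')).
    { unfold Rmax; destruct (Rle_dec 0 (b + y)), (Rle_dec 0 (b' + y)); lra. }
    assert (om n b * (b - b') <= 4 * c' * (b - b')) by (apply Rmult_le_compat_r; lra).
    assert (0 <= (c - c') * (Rmax 0 (b' + y) + (b - b') - Rmax 0 (b + y)))
      by (apply Rmult_le_pos; lra).
    nra.
Qed.

(** The slope at [b] is the chord at a grid point below [b], which for [b <= 0] is no longer than
    the chord at [b]. *)
Lemma om_in_disk n b : (n <= 200)%nat -> b <= 0 -> -800 < b -> b <= 4 * IZR (Z.of_nat n) - 800 ->
  0 <= om n b /\ om n b * om n b + 4 * (b * b) <= 4 * (800 * 800).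
Proof.
  induction n as [|n IH]; intros Hn Hb0 Hb Hbn; [simpl in Hbn; lra|].
  rewrite om_succ by (rewrite Nat2Z.inj_succ in Hbn; exact Hbn).
  destruct (Rle_dec b (4 * IZR (Z.of_nat n) - 800)) as [H|H]; [apply IH; auto; lia|].
  rewrite om_above by (lia || lra).
  assert (Hc0 : (0 <= chord (200 - Z.of_nat n))%Z).
  { pose proof (chord_decreasing (199 - Z.of_nat n) ltac:(lia)) as Hc.
    now replace (200 - Z.of_nat n)%Z with (199 - Z.of_nat n + 1)%Z by lia. }
  pose proof (chord_spec _ Hc0) as Hc; apply IZR_le in Hc, Hc0.
  rewrite plus_IZR, !mult_IZR, minus_IZR in Hc.
  set (c := IZR (chord (200 - Z.of_nat n))) in *.
  set (k := IZR (Z.of_nat n)) in *.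
  split; [lra|].
  assert (b * b <= (4 * (200 - k)) * (4 * (200 - k))) by nra.
  nra.
Qed.

(** Beyond its last kink [Phi n] is linear, and the kinks sum up to the lower Riemann sum [cap]. *)
Lemma Phi_value n b : (n <= 200)%nat -> 4 * IZR (Z.of_nat n) - 800 <= b ->
  Phi n b = 4 * IZR (chord (200 - Z.of_nat n)) * (b - 4 * IZR (Z.of_nat n) + 800)
            + 16 * IZR (cap (200 - Z.of_nat n)).
Proof.
  induction n as [|n IH]; intros Hn Hb.
  - change (chord (200 - Z.of_nat 0)) with 0%Z; change (cap (200 - Z.of_nat 0)) with 0%Z; simpl; lra.
  - rewrite Nat2Z.inj_succ in *; unfold Z.succ in *; rewrite plus_IZR in *.
    cbn [Phi]; rewrite IH by (lia || lra).
    replace (200 - (Z.of_nat n + 1))%Z with (199 - Z.of_nat n)%Z by lia.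
    rewrite (cap_step (199 - Z.of_nat n)) by lia.
    replace (199 - Z.of_nat n + 1)%Z with (200 - Z.of_nat n)%Z by lia.
    rewrite !minus_IZR, plus_IZR, Rmax_right by (rewrite ?minus_IZR; lra); ring.
Qed.

Lemma smooth_good p Q t j : reserve_ok p Q -> (1 <= j)%Z -> (t <= 200)%Z ->
  cell_good (below disk Q (4 * IZR t)) j (smooth p t j).
Proof.
  intros HQ Hj Ht h l Hd Hh Ha.
  destruct (descending_cons _ _ Hd) as (Hpos & _).
  unfold smooth in Ha; destruct (Z.leb_spec (t + 200) j) as [Htj|Htj].
  { exfalso; pose proof (total_area_nonneg (h :: l)); lra. }
  set (c := Z.max t 0) in *.
  (* This keeps exactly the kinks up to height [-4 * c]. *)
  set (n := Z.to_nat (200 - c)).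
  assert (Hc : (0 <= c <= 200)%Z) by lia.
  assert (Hn : Z.of_nat n = (200 - c)%Z) by (unfold n; lia).
  assert (Hn' : (n <= 200)%nat) by lia.
  assert (HnR : IZR (Z.of_nat n) = 200 - IZR c) by now rewrite Hn, minus_IZR.
  assert (Hct : IZR t <= IZR c /\ 0 <= IZR c) by (split; apply IZR_le; lia).
  assert (Hval : 16 * IZR (cap_below t (t - j)) <= Phi n (4 * IZR (t - j))).
  { unfold cap_below; fold c.
    destruct (Z.leb_spec (t - j) (- c)) as [Hb|Hb].
    - set (n' := Z.to_nat (200 + (t - j))).
      assert (E : Z.of_nat n' = (200 + (t - j))%Z) by (unfold n'; lia).
      assert (Hnn : (n' <= n)%nat) by lia.
      transitivity (Phi n' (4 * IZR (t - j))).
      + rewrite Phi_value; [|lia|rewrite E, plus_IZR; lra].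
        rewrite E, plus_IZR; replace (200 - (200 + (t - j)))%Z with (- (t - j))%Z by lia; lra.
      + clear - Hnn Hn' E; induction Hnn as [|m Hm IH]; [lra|].
        specialize (IH ltac:(lia)); etransitivity; [exact IH|]; cbn [Phi].
        pose proof (chord_decreasing (199 - Z.of_nat m) ltac:(lia)) as [_ Hc]; apply IZR_le in Hc.
        rewrite (minus_IZR (chord _)).
        assert (0 <= 4 * (IZR (chord (199 - Z.of_nat m)) - IZR (chord (199 - Z.of_nat m + 1)))
                     * Rmax 0 (4 * IZR (t - j) + 4 * IZR (199 - Z.of_nat m)))
          by (apply Rmult_le_pos; [lra|apply Rmax_l]).
        lra.
    - apply IZR_lt in Hb; rewrite opp_IZR in Hb.
      rewrite Phi_value by (auto; lra).
      rewrite HnR, Hn; replace (200 - (200 - c))%Z with c by lia.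
      rewrite plus_IZR, mult_IZR, plus_IZR; lra. }
  apply (below_of_potential disk Q (-800) (4 * IZR t) (16 * IZR (bonus p j)) (4 * IZR j)
    (om n) (Phi n)); auto.
  - apply HQ.
  - intros; now apply (bonus_reserve p Q j).
  - intros; now apply Phi_below.
  - now apply Phi_subgradient.
  - intros t' b Hb Hbt Ht'; exists (- om n b / 2).
    replace (- om n b / 2 + om n b) with (om n b / 2) by lra.
    destruct (Rle_dec b (- 4 * IZR c)) as [Hbc|Hbc].
    + destruct (om_in_disk n b) as [_ H]; auto; try lra.
      apply box_in_disk; auto.
      assert (t' * t' <= b * b) by nra; lra.
    + rewrite om_above by (auto; lra).
      rewrite Hn; replace (200 - (200 - c))%Z with c by lia.
      assert (Hcpos : 0 < IZR c) by (destruct Hct as [? [?|E]]; [lra|rewrite <- E in *; lra]).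
      assert (Ec : c = t) by (apply lt_IZR in Hcpos; lia); rewrite Ec in *.
      assert (Hch : (0 <= chord t)%Z).
      { replace t with (t - 1 + 1)%Z by lia.
        apply chord_decreasing; apply lt_IZR in Hcpos; lia. }
      pose proof (chord_spec _ Hch) as H; apply IZR_le in H.
      rewrite plus_IZR, !mult_IZR in H.
      apply box_in_disk; auto; nra.
  - lra.
  - lra.
  - repeat rewrite ?plus_IZR, ?minus_IZR, ?mult_IZR in Ha.
    rewrite minus_IZR in Hval.
    assert (Hmono : Phi n (4 * (IZR t - IZR j)) <= Phi n (4 * IZR t - h)).
    { clear - Hh Hn'; induction n as [|n IH]; [simpl; lra|]; cbn [Phi].
      specialize (IH ltac:(lia)).
      pose proof (chord_decreasing (199 - Z.of_nat n) ltac:(lia)) as [_ Hc]; apply IZR_le in Hc.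
      rewrite (minus_IZR (chord _)); set (y := 4 * IZR (199 - Z.of_nat n)).
      assert (Rmax 0 (4 * (IZR t - IZR j) + y) <= Rmax 0 (4 * IZR t - h + y))
        by (apply Rle_max_compat_l; lra).
      nra. }
    apply IZR_lt in Htj; rewrite plus_IZR in Htj.
    apply IZR_le in Hj.
    rewrite Rmax_right by lra.
    assert (h * (4 * IZR t - h - -800) <= 4 * IZR j * (4 * (200 + IZR t - (IZR j - 1))))
      by (apply Rmult_le_compat; lra).
    assert (4 * (IZR j - 1) * (4 * (IZR j - 1)) <= h * h) by (apply Rmult_le_compat; lra).
    lra.
Qed.

Lemma nth_hd_skip (rows : list (list Z)) : nth 0 rows [] = hd [] rows.
Proof. now destruct rows. Qed.

Lemma nth_tl {A} i (l : list A) d : nth i (tl l) d = nth (S i) l d.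
Proof. destruct l; simpl; auto; now destruct i. Qed.

Lemma make_row_good p Q t k : reserve_ok p Q -> (t <= 200)%Z -> forall j rows, (1 <= j)%Z ->
  (forall i, row_good p Q (t - j - Z.of_nat i) (nth i rows [])) ->
  forall i, cell_good (below disk Q (4 * IZR t)) (j + Z.of_nat i)
    (nth i (make_row p t j k rows) (base p (j + Z.of_nat i))).
Proof.
  intros HQ Ht; induction k as [|k IH]; intros j rows Hj Hrows i.
  - simpl; replace (match i with O | S _ => base p (j + Z.of_nat i) end)
      with (base p (j + Z.of_nat i)) by now destruct i.
    apply base_good; auto; lia.
  - cbn [make_row]; destruct i as [|i]; cbn [nth].
    + rewrite Z.add_0_r; apply cell_good_max; [apply rowwise_good|apply smooth_good]; auto.
      specialize (Hrows O); now rewrite nth_hd_skip, Z.sub_0_r in Hrows.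
    + replace (j + Z.of_nat (S i))%Z with (j + 1 + Z.of_nat i)%Z by lia.
      apply IH; [lia|]; intros i'; rewrite nth_tl.
      specialize (Hrows (S i')).
      now replace (t - (j + 1) - Z.of_nat i')%Z with (t - j - Z.of_nat (S i'))%Z by lia.
Qed.

Lemma row_good_nil p Q t : reserve_ok p Q -> row_good p Q t [].
Proof.
  intros HQ i; replace (nth i [] _) with (base p (Z.of_nat i + 1)) by now destruct i.
  apply base_good; auto; lia.
Qed.

Lemma make_table_good p Q n : reserve_ok p Q -> forall t rows, (t + Z.of_nat n <= 200)%Z ->
  (forall i, row_good p Q (t - 1 - Z.of_nat i) (nth i rows [])) ->
  forall i, row_good p Q (t + Z.of_nat n - 1 - Z.of_nat i) (nth i (make_table p t n rows) []).
Proof.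
  intros HQ; induction n as [|n IH]; intros t rows Ht Hrows i.
  - simpl Z.of_nat; rewrite Z.add_0_r; apply Hrows.
  - cbn [make_table].
    replace (t + Z.of_nat (S n))%Z with (t + 1 + Z.of_nat n)%Z by lia.
    apply IH; [lia|]; intros [|i'].
    + replace (t + 1 - 1 - Z.of_nat 0)%Z with t by lia; intros i'.
      pose proof (make_row_good p Q t (row_length t) HQ ltac:(lia) 1 rows ltac:(lia) Hrows i') as H.
      now rewrite (Z.add_comm 1) in H.
    + replace (t + 1 - 1 - Z.of_nat (S i'))%Z with (t - 1 - Z.of_nat i')%Z by lia; apply Hrows.
Qed.

Lemma table_good p Q : reserve_ok p Q ->
  forall i, row_good p Q (135 - Z.of_nat i) (nth i (table p) []).
Proof.
  intros HQ i; change 135%Z with (-199 + Z.of_nat 335 - 1)%Z.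
  apply make_table_good; auto; [lia|].
  intros i'; replace (nth i' [] []) with (@nil Z) by now destruct i'.
  now apply row_good_nil.
Qed.

(** * The search through all side lengths *)

Open Scope Z_scope.
Open Scope lazy_bool_scope.

Record solver := mkSolver { res : reserve; rows : list (list Z) }.

Definition solver_row (s : solver) (t : Z) : list Z :=
  if 135 <? t then [] else nth (Z.to_nat (135 - t)) (rows s) [].

Definition up4 (v : Z) : Z := - (- v / 4).

(* A certified area for the squares that follow those already put into a row with bottom [b] and
   free length [rest], if their sides are at most [jmax]. *)
Definition next (s : solver) (b rest jmax : Z) : Z :=
  16 * row_threshold (res s) (solver_row s (b / 4)) (rest / 4) (up4 jmax).

Fixpoint row_inf (p : reserve) (row : list Z) (j : Z) (k : nat) : Z :=
  match k with
  | O => 100000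
  | S k' =>
    Z.min (match row with v :: _ => v | [] => base p j end) (row_inf p (tl row) (j + 1) k')
  end.

(* A certified area for squares below [b] the largest of which has side in the interval from [lo]
   to [hi]. *)
Definition range (s : solver) (b lo hi : Z) : Z :=
  16 * row_inf (res s) (skipn (Z.to_nat (lo / 4)) (solver_row s (b / 4)))
         (lo / 4 + 1) (Z.to_nat (up4 hi - lo / 4)).

Definition fits (w b t : Z) : bool := 4 * Z.max (b * b) (t * t) + w * w <=? 4 * (800 * 800).

Definition wide (b t : Z) : Z := Z.sqrt (4 * (800 * 800 - Z.max (b * b) (t * t))).

(* Here and below the sides [a >= b >= c] of the three largest squares satisfy
   [a0 < a <= a1], [b0 < b <= b1] and [c0 < c <= c1], and [A] bounds the area without [a]. *)
Definition top (a1 : Z) : Z := Z.sqrt (4 * (800 * 800) - a1 * a1) / 2 - a1.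

(** The pockets have side [336 = 4 * 84]. They are available if the box made of both pockets and the
    gap for the top square lies in the disk. *)
Definition pick (s0 s1 : solver) (a1 t : Z) : solver :=
  if fits (2 * ((a1 + 1) / 2 + 336)) t (t + 336) then s1 else s0.

Definition try_top2 (s0 s1 : solver) (A a1 b0 b1 : Z) : bool :=
  let t := top a1 in
  let b := t - b1 in
  let W := wide b t in
  fits a1 t (t + a1) &&& (b1 <=? W) &&&
  (A <? b0 * b0 + next (pick s0 s1 a1 t) b (W - b1) b1).

(** Whether [c] fits beside [b] can vary within the box of sides; then both outcomes have to be
    certified. *)
Definition try_top3 (s0 s1 : solver) (A a1 b0 b1 c0 c1 : Z) : bool :=
  let t := top a1 in
  let b := t - b1 in
  let W := wide b t in
  fits a1 t (t + a1) &&& (b1 <=? W) &&&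
  (let s := pick s0 s1 a1 t in
   (A <? b0 * b0 + c0 * c0 + next s b (W - b1 - c1) c1) &&&
   ((b1 + c1 <=? W) ||| (A <? b0 * b0 + range s b c0 c1))).

Definition try_pair (s0 : solver) (A a1 b0 b1 c0 c1 : Z) : bool :=
  let w := a1 + b1 in
  let t := Z.sqrt (4 * (800 * 800) - w * w) / 2 in
  fits w (t - a1) t &&& (A <? b0 * b0 + range s0 (t - a1) c0 c1).

(** [next] is taken at [t] and not at [t - c1]: the squares that overflow the single row go to the
    other side of the stack, where nothing has been placed yet. *)
Definition try_stack (s0 : solver) (A a1 b0 c0 c1 : Z) : bool :=
  let t := - a1 / 2 in
  let W := wide (t - c1) t in
  (c1 <=? W) &&& (A <? b0 * b0 + c0 * c0 + next s0 t (W - c1) c1).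

Definition settled3 (s0 s1 : solver) (a0 a1 b0 b1 c0 c1 : Z) : bool :=
  let A := 1024000 - a0 * a0 in
  (b1 <=? c0) ||| (A <? b0 * b0 + c0 * c0) ||| try_pair s0 A a1 b0 b1 c0 c1 |||
  try_top3 s0 s1 A a1 b0 b1 c0 c1 ||| try_stack s0 A a1 b0 c0 c1.

(** Bisection along a longest edge of the box; [n] only bounds the depth. *)
Fixpoint search3 (s0 s1 : solver) (n : nat) (a0 a1 b0 b1 c0 c1 : Z) : bool :=
  settled3 s0 s1 a0 a1 b0 b1 c0 c1 |||
  match n with
  | O => false
  | S n' =>
    if (b1 - b0 <=? c1 - c0) &&& (a1 - a0 <=? c1 - c0) then
      let m := (c0 + c1) / 2 in
      search3 s0 s1 n' a0 a1 b0 b1 c0 m &&& search3 s0 s1 n' a0 a1 b0 b1 m c1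
    else if a1 - a0 <=? b1 - b0 then
      let m := (b0 + b1) / 2 in
      search3 s0 s1 n' a0 a1 b0 m c0 c1 &&& search3 s0 s1 n' a0 a1 m b1 c0 c1
    else
      let m := (a0 + a1) / 2 in
      search3 s0 s1 n' a0 m b0 b1 c0 c1 &&& search3 s0 s1 n' m a1 b0 b1 c0 c1
  end.

Definition settled2 (s0 s1 : solver) (a0 a1 b0 b1 : Z) : bool :=
  let A := 1024000 - a0 * a0 in
  (a1 <=? b0) ||| (A <? b0 * b0) ||| try_top2 s0 s1 A a1 b0 b1.

Fixpoint search2 (s0 s1 : solver) (n : nat) (a0 a1 b0 b1 : Z) : bool :=
  settled2 s0 s1 a0 a1 b0 b1 |||
  match n with
  | O => false
  | S n' =>
    if (b1 - b0 <=? 16) &&& (a1 - a0 <=? 16) then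
      search3 s0 s1 40 a0 a1 b0 b1 0 (Z.min b1 (Z.sqrt (1024000 - a0 * a0 - b0 * b0) + 1))
    else if a1 - a0 <=? b1 - b0 then
      let m := (b0 + b1) / 2 in search2 s0 s1 n' a0 a1 b0 m &&& search2 s0 s1 n' a0 a1 m b1
    else
      let m := (a0 + a1) / 2 in search2 s0 s1 n' a0 m b0 b1 &&& search2 s0 s1 n' m a1 b0 b1
  end.

Definition plain : reserve := mkReserve 0 0.

(** Two pockets of side 84 grid units; [3528 = 84^2 / 2] is half the area of one of them. *)
Definition pockets : reserve := mkReserve 84 3528.

(* [j] is the rounded up side of the largest square.  Unless it is small, the first row starts
   where two squares of this size fit side by side. *)
Definition settled1 (s0 : solver) (j : Z) : bool :=
  if j <=? 56 then 64000 <? smooth plain 120 j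
  else
    let t := Z.sqrt (200 * 200 - j * j) in
    64000 <? rowwise plain (solver_row s0 (t - j)) t j.

(* Stated with local definitions in place of constants: unfolding a constant here could make the
   kernel run the search without its virtual machine. *)
Lemma search_succeeds :
  let s0 := mkSolver plain (table plain) in
  let s1 := mkSolver pockets (table pockets) in
  (forallb (fun i => settled1 s0 (Z.of_nat i + 1)) (seq 0 123) &&&
   search2 s0 s1 60 492 1516 0 1024) = true.
Proof. vm_compute; reflexivity. Qed.

Close Scope lazy_bool_scope.
Close Scope Z_scope.

(** * Correctness of the search *)

Definition empty : container := fun l => l = [].

Definition pocket_pair (e t : R) : container := fun l => exists l1 l2,
  Permutation l (l1 ++ l2) /\ packs (box e (e + 336) t (t + 336)) l1 /\
  packs (box (- e - 336) (- e) t (t + 336)) l2.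

Definition solver_ok (s : solver) (Q : container) : Prop :=
  reserve_ok (res s) Q /\ forall i, row_good (res s) Q (135 - Z.of_nat i) (nth i (rows s) []).

Lemma solver_ok_table p Q : reserve_ok p Q -> solver_ok (mkSolver p (table p)) Q.
Proof. intros H; split; [exact H|exact (table_good p Q H)]. Qed.

Lemma reserve_ok_plain : reserve_ok plain empty.
Proof.
  split; [reflexivity|]; intros h l Hd Hh _.
  apply descending_cons in Hd; simpl in Hh; lra.
Qed.

(** The largest square gets one pocket for itself, and the others fill at most half of the other
    pocket. *)
Lemma reserve_ok_pockets e t : reserve_ok pockets (pocket_pair e t).
Proof.
  split.
  - exists [], []; repeat split; auto using packs_nil.
  - intros h l Hd Hh Ha; simpl in Hh, Ha; destruct (descending_cons _ _ Hd) as (Hpos & Hf & Hd').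
    exists [h], l; split; [apply Permutation_refl|split].
    + apply packs_box_single; lra.
    + replace (- e) with (- e - 336 + 336) at 2 by lra.
      apply packs_square_container; auto; [|lra].
      revert Hf; apply Forall_impl; intros; lra.
Qed.

Lemma solver_row_good s Q t : solver_ok s Q -> row_good (res s) Q t (solver_row s t).
Proof.
  intros [HQ Hs]; unfold solver_row; destruct (Z.ltb_spec 135 t); [now apply row_good_nil|].
  specialize (Hs (Z.to_nat (135 - t))); rewrite Z2Nat.id in Hs by lia.
  now replace (135 - (135 - t))%Z with t in Hs by lia.
Qed.

Lemma div4_le v : 4 * IZR (v / 4) <= IZR v.
Proof.
  replace (4 * IZR (v / 4)) with (IZR (4 * (v / 4))) by now rewrite mult_IZR.
  apply IZR_le; apply Z.mul_div_le; lia.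
Qed.

Lemma up4_ge v : IZR v <= 4 * IZR (up4 v).
Proof. unfold up4; rewrite opp_IZR; pose proof (div4_le (- v)) as H; rewrite opp_IZR in H; lra. Qed.

Lemma wide_spec b t : (0 < wide b t)%Z ->
  IZR (wide b t) * IZR (wide b t) + 4 * (IZR b * IZR b) <= 4 * (800 * 800) /\
  IZR (wide b t) * IZR (wide b t) + 4 * (IZR t * IZR t) <= 4 * (800 * 800).
Proof.
  unfold wide; set (X := (4 * (800 * 800 - Z.max (b * b) (t * t)))%Z); intros H.
  destruct (Z.lt_ge_cases X 0) as [HX|HX]; [rewrite Z.sqrt_neg in H; lia|].
  pose proof (Z.sqrt_spec X HX) as [Hs _]; set (W := Z.sqrt X) in *.
  rewrite <- !mult_IZR, <- !plus_IZR; split; apply IZR_le; unfold X in Hs; lia.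
Qed.

Lemma fits_spec w b t : fits w b t = true ->
  IZR w * IZR w + 4 * (IZR b * IZR b) <= 4 * (800 * 800) /\
  IZR w * IZR w + 4 * (IZR t * IZR t) <= 4 * (800 * 800).
Proof.
  unfold fits; intros H; apply Z.leb_le in H.
  rewrite <- !mult_IZR, <- !plus_IZR; split; apply IZR_le; lia.
Qed.

Lemma below_mono G Q t t' l : t' <= t -> below G Q t' l -> below G Q t l.
Proof.
  intros Ht (l1 & l2 & Hp & Hl1 & HQ); exists l1, l2; repeat split; auto.
  revert Hl1; apply packs_incl; intros x y [? ?]; split; auto; lra.
Qed.

Lemma next_fill s Q t v rest jm pre l : solver_ok s Q -> (0 < v <= wide (t - v) t)%Z ->
  Forall (fun a => 0 < a <= IZR v) (pre ++ l) -> descending l ->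
  Forall (fun a => a <= IZR jm) l ->
  sum pre <= IZR (wide (t - v) t) -> IZR rest <= IZR (wide (t - v) t) - sum pre ->
  total_area l < IZR (next s (t - v) rest jm) ->
  below disk Q (IZR t) (pre ++ l).
Proof.
  intros Hs Hv Hf Hd Hjm Hpre Hrest Ha.
  destruct (wide_spec (t - v) t ltac:(lia)) as [Hw1 Hw2].
  pose proof (div4_le (t - v)) as Hdiv; rewrite minus_IZR in *.
  assert (Hv0 : 0 < IZR v) by (apply IZR_lt; lia).
  unfold next in Ha; rewrite mult_IZR in Ha.
  apply (below_fill_row (res s) Q (IZR t) ((t - v) / 4) (solver_row s ((t - v) / 4)) (rest / 4)
    (up4 jm) pre l (IZR v) (IZR (wide (t - v) t))); auto; try lra.
  - apply Hs.
  - now apply solver_row_good.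
  - apply box_in_disk; lra.
  - revert Hjm; apply Forall_impl; intros; pose proof (up4_ge jm); lra.
  - pose proof (div4_le rest); lra.
Qed.

Lemma row_inf_le p k : forall row j i, (i < k)%nat ->
  (row_inf p row j k <= nth i row (base p (j + Z.of_nat i)))%Z.
Proof.
  induction k as [|k IH]; intros row j i Hi; [lia|]; cbn [row_inf].
  destruct i as [|i].
  - rewrite Z.add_0_r; destruct row; simpl; lia.
  - specialize (IH (tl row) (j + 1)%Z i ltac:(lia)); rewrite nth_tl in IH.
    replace (j + 1 + Z.of_nat i)%Z with (j + Z.of_nat (S i))%Z in IH by lia; lia.
Qed.

Lemma range_below s Q t lo hi c l : solver_ok s Q -> descending (c :: l) -> (0 <= lo)%Z ->
  IZR lo < c <= IZR hi -> total_area (c :: l) < IZR (range s t lo hi) ->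
  below disk Q (IZR t) (c :: l).
Proof.
  intros Hs Hd Hlo Hc Ha.
  apply below_mono with (4 * IZR (t / 4)); [apply div4_le|].
  destruct (exists_cell c) as [i Hi]; [apply (descending_cons _ _ Hd)|].
  pose proof (solver_row_good s Q (t / 4) Hs i) as Hg; set (row := solver_row s (t / 4)) in *.
  apply Hg; auto.
  { rewrite plus_IZR; lra. }
  assert (H1 : (lo / 4 <= Z.of_nat i)%Z).
  { enough (lo / 4 < Z.of_nat i + 1)%Z by lia.
    apply lt_IZR; rewrite plus_IZR; pose proof (div4_le lo); lra. }
  assert (H2 : (Z.of_nat i < up4 hi)%Z).
  { apply lt_IZR; pose proof (up4_ge hi); lra. }
  assert (0 <= lo / 4)%Z by (apply Z.div_pos; lia).
  pose proof (row_inf_le (res s) (Z.to_nat (up4 hi - lo / 4)) (skipn (Z.to_nat (lo / 4)) row)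
    (lo / 4 + 1) (i - Z.to_nat (lo / 4)) ltac:(lia)) as Hle.
  rewrite nth_skipn in Hle.
  replace (Z.to_nat (lo / 4) + (i - Z.to_nat (lo / 4)))%nat with i in Hle by lia.
  replace (lo / 4 + 1 + Z.of_nat (i - Z.to_nat (lo / 4)))%Z with (Z.of_nat i + 1)%Z in Hle by lia.
  unfold range in Ha; fold row in Ha; rewrite mult_IZR in Ha; apply IZR_le in Hle; lra.
Qed.

Lemma packs_below_empty t l : below disk empty t l -> packs (fun x y => disk x y /\ y <= t) l.
Proof.
  intros (l1 & l2 & Hp & Hl1 & ->); rewrite app_nil_r in Hp; symmetry in Hp.
  now apply (packs_perm _ _ _ Hp).
Qed.

Lemma packs_top (Q : container) t a l :
  (forall l2, Q l2 -> packs (fun x y => disk x y /\ t <= y) (a :: l2)) ->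
  below disk Q t l -> packs disk (a :: l).
Proof.
  intros HQ (l1 & l2 & Hp & Hl1 & Hl2).
  apply packs_perm with (l1 ++ a :: l2).
  - rewrite Hp; symmetry; apply Permutation_middle.
  - apply (packs_above (fun x y => disk x y /\ y <= t) (fun x y => disk x y /\ t <= y) _ t);
      try tauto; auto.
Qed.

(** Hides the choice of solver: whatever the rows leave to [Q] can be placed above height [t]
    together with [a]. *)
Lemma pick_spec s0 s1 a a1 t : solver_ok s0 empty ->
  (forall e t, solver_ok s1 (pocket_pair e t)) ->
  0 < a <= IZR a1 -> fits a1 t (t + a1) = true ->
  exists Q, solver_ok (pick s0 s1 a1 t) Q /\
    forall l, below disk Q (IZR t) l -> packs disk (a :: l).
Proof.
  intros H0 H1 Ha Hf; apply fits_spec in Hf; destruct Hf as [Hf1 Hf2]; rewrite plus_IZR in Hf2.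
  assert (Hbox : forall x y, box (- a / 2) (a / 2) (IZR t) (IZR t + IZR a1) x y ->
    disk x y /\ IZR t <= y).
  { intros x y [Hx Hy]; split; [|lra].
    apply (box_in_disk (IZR a1) (IZR t) (IZR t + IZR a1)); [lra..|]; split; lra. }
  unfold pick; destruct (fits _ t (t + 336)) eqn:Hp.
  - set (e := ((a1 + 1) / 2)%Z) in *.
    assert (He : a / 2 <= IZR e).
    { assert (H : (a1 <= 2 * e)%Z).
      { pose proof (Z.div_mod (a1 + 1) 2 ltac:(lia)); fold e in H.
        pose proof (Z.mod_pos_bound (a1 + 1) 2 ltac:(lia)); lia. }
      apply IZR_le in H; rewrite mult_IZR in H; lra. }
    apply fits_spec in Hp; destruct Hp as [Hp1 Hp2].
    rewrite mult_IZR, plus_IZR in Hp1; rewrite mult_IZR, !plus_IZR in Hp2.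
    exists (pocket_pair (IZR e) (IZR t)); split; auto.
    intros l; apply packs_top; intros l2 (r1 & r2 & Hperm & Hr1 & Hr2).
    apply packs_perm with (r2 ++ [a] ++ r1).
    { rewrite Hperm; simpl; rewrite <- Permutation_middle.
      apply perm_skip, Permutation_app_comm. }
    assert (Hin : forall x y, - (IZR e + 336) <= x <= IZR e + 336 ->
      IZR t <= y <= IZR t + 336 -> disk x y /\ IZR t <= y).
    { intros x y Hx Hy; split; [|lra].
      apply (box_in_disk (2 * (IZR e + 336)) (IZR t) (IZR t + 336)); [lra..|]; split; lra. }
    apply (packs_beside (box (- IZR e - 336) (- IZR e) (IZR t) (IZR t + 336))
      (fun x y => (disk x y /\ IZR t <= y) /\ - IZR e <= x) _ (- IZR e));
      try tauto; auto; try (unfold box; intros; lra).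
    { intros x y [Hx Hy]; apply Hin; lra. }
    apply (packs_beside (box (- a / 2) (a / 2) (IZR t) (IZR t + IZR a1))
      (box (IZR e) (IZR e + 336) (IZR t) (IZR t + 336)) _ (IZR e));
      try (unfold box; intros; lra); auto.
    { intros x y Hxy; split; auto; destruct Hxy; lra. }
    { intros x y [Hx Hy]; split; [apply Hin|]; lra. }
    apply packs_box_single; lra.
  - exists empty; split; auto; intros l; apply packs_top; intros l2 ->.
    apply packs_incl with (1 := Hbox), packs_box_single; lra.
Qed.

Lemma try_top2_spec s0 s1 A a1 b0 b1 a b l : solver_ok s0 empty ->
  (forall e t, solver_ok s1 (pocket_pair e t)) ->
  0 < a <= IZR a1 -> (0 <= b0)%Z -> IZR b0 < b <= IZR b1 ->
  descending (b :: l) -> total_area (b :: l) <= IZR A ->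
  try_top2 s0 s1 A a1 b0 b1 = true -> packs disk (a :: b :: l).
Proof.
  intros H0 H1 Ha Hb0 Hb Hd Har Ht; unfold try_top2 in Ht; set (t := top a1) in *.
  destruct (fits a1 t (t + a1)) eqn:Hf; [|discriminate].
  destruct (Z.leb_spec b1 (wide (t - b1) t)) as [Hw|]; [|discriminate].
  apply Z.ltb_lt, IZR_lt in Ht; rewrite plus_IZR, mult_IZR in Ht.
  destruct (pick_spec s0 s1 a a1 t) as (Q & HQ & Hpack); auto.
  apply Hpack; destruct (descending_cons _ _ Hd) as (Hpos & Hle & Hd').
  assert (Hb1 : (0 < b1)%Z) by (apply lt_IZR; lra).
  assert (Hb0' : 0 <= IZR b0) by now apply IZR_le.
  change (total_area (b :: l)) with (b * b + total_area l) in Har.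
  apply IZR_le in Hw.
  apply (next_fill _ Q t b1 (wide (t - b1) t - b1) b1 [b] l HQ); auto; simpl; try lra.
  - split; auto; now apply le_IZR.
  - constructor; [lra|]; destruct Hd' as [Hp _]; rewrite Forall_forall in *; intros s Hs.
    specialize (Hp s Hs); specialize (Hle s Hs); lra.
  - revert Hle; apply Forall_impl; intros; lra.
  - rewrite minus_IZR; lra.
  - assert (IZR b0 * IZR b0 <= b * b) by (apply Rmult_le_compat; lra); lra.
Qed.

Lemma try_top3_spec s0 s1 A a1 b0 b1 c0 c1 a b c l : solver_ok s0 empty ->
  (forall e t, solver_ok s1 (pocket_pair e t)) ->
  0 < a <= IZR a1 -> (0 <= b0)%Z -> IZR b0 < b <= IZR b1 -> (0 <= c0)%Z -> IZR c0 < c <= IZR c1 ->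
  descending (b :: c :: l) -> total_area (b :: c :: l) <= IZR A ->
  try_top3 s0 s1 A a1 b0 b1 c0 c1 = true -> packs disk (a :: b :: c :: l).
Proof.
  intros H0 H1 Ha Hb0 Hb Hc0 Hc Hd Har Ht; unfold try_top3 in Ht; set (t := top a1) in *.
  destruct (fits a1 t (t + a1)) eqn:Hf; [|discriminate].
  destruct (Z.leb_spec b1 (wide (t - b1) t)) as [Hw|]; [|discriminate].
  destruct (pick_spec s0 s1 a a1 t) as (Q & HQ & Hpack); auto.
  set (s := pick s0 s1 a1 t) in *; cbv zeta in Ht.
  destruct (Z.ltb_spec A (b0 * b0 + c0 * c0 + next s (t - b1) (wide (t - b1) t - b1 - c1) c1))
    as [Hfit|]; [|discriminate].
  apply IZR_lt in Hfit; rewrite !plus_IZR, !mult_IZR in Hfit.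
  apply Hpack.
  destruct (descending_cons _ _ Hd) as (Hpos & Hle & Hd').
  destruct (descending_cons _ _ Hd') as (Hpos' & Hle' & Hd'').
  assert (Hb1 : (0 < b1)%Z) by (apply lt_IZR; lra).
  assert (Hb0' : 0 <= IZR b0) by now apply IZR_le.
  assert (Hc0' : 0 <= IZR c0) by now apply IZR_le.
  change (total_area (b :: c :: l)) with (b * b + (c * c + total_area l)) in Har.
  assert (Hbb : IZR b0 * IZR b0 <= b * b) by (apply Rmult_le_compat; lra).
  assert (Hcc : IZR c0 * IZR c0 <= c * c) by (apply Rmult_le_compat; lra).
  assert (Hcb : c <= b) by now inversion Hle.
  assert (HwR : IZR b1 <= IZR (wide (t - b1) t)) by now apply IZR_le.
  assert (Hall : Forall (fun s => 0 < s <= IZR b1) (b :: c :: l)).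
  { destruct Hd as [Hp _]; rewrite Forall_forall in Hp, Hle |- *; intros r Hr; split; auto.
    destruct Hr as [->|Hr]; [lra|]; specialize (Hle r Hr); lra. }
  destruct (Rle_dec (b + c) (IZR (wide (t - b1) t))) as [Hbc|Hbc].
  - apply (next_fill s Q t b1 (wide (t - b1) t - b1 - c1) c1 [b; c] l HQ); auto; simpl; try lra.
    + revert Hle'; apply Forall_impl; intros; lra.
    + rewrite !minus_IZR; lra.
  - destruct (Z.leb_spec (b1 + c1) (wide (t - b1) t)) as [Hn|_].
    { apply IZR_le in Hn; rewrite plus_IZR in Hn; lra. }
    apply Z.ltb_lt, IZR_lt in Ht; rewrite plus_IZR, mult_IZR in Ht.
    change (b :: c :: l) with ([b] ++ c :: l).
    destruct (wide_spec (t - b1) t ltac:(lia)) as [Hw1 Hw2].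
    apply below_row with (- IZR (wide (t - b1) t) / 2) (IZR (wide (t - b1) t) / 2)
      (IZR (t - b1)) (IZR (t - b1)); try (rewrite minus_IZR in *; lra).
    + apply box_in_disk; rewrite ?minus_IZR in *; lra.
    + apply packs_box_single; rewrite ?minus_IZR; lra.
    + apply (range_below s Q (t - b1) c0 c1); auto.
      change (total_area (c :: l)) with (c * c + total_area l); lra.
Qed.

Lemma try_pair_spec s0 A a1 b0 b1 c0 c1 a b c l : solver_ok s0 empty ->
  0 < a <= IZR a1 -> (0 <= b0)%Z -> IZR b0 < b <= IZR b1 -> (0 <= c0)%Z -> IZR c0 < c <= IZR c1 ->
  descending (a :: b :: c :: l) -> total_area (b :: c :: l) <= IZR A ->
  try_pair s0 A a1 b0 b1 c0 c1 = true -> packs disk (a :: b :: c :: l).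
Proof.
  intros H0 Ha Hb0 Hb Hc0 Hc Hd Har Ht; unfold try_pair in Ht.
  set (t := (Z.sqrt _ / 2)%Z) in *.
  destruct (fits (a1 + b1) (t - a1) t) eqn:Hf; [|discriminate].
  apply Z.ltb_lt, IZR_lt in Ht; rewrite plus_IZR, mult_IZR in Ht.
  apply fits_spec in Hf; rewrite plus_IZR in Hf.
  destruct (descending_cons _ _ Hd) as (_ & Hle & Hd').
  destruct (descending_cons _ _ Hd') as (Hpos & _ & Hd'').
  assert (Hba : b <= a) by now inversion Hle.
  assert (Hb0' : 0 <= IZR b0) by now apply IZR_le.
  assert (Hbb : IZR b0 * IZR b0 <= b * b) by (apply Rmult_le_compat; lra).
  change (total_area (b :: c :: l)) with (b * b + total_area (c :: l)) in Har.
  enough (H : below disk empty (IZR t) ([a; b] ++ c :: l)).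
  { apply packs_below_empty in H; revert H; apply packs_incl; tauto. }
  apply below_row with (- (IZR a1 + IZR b1) / 2) ((IZR a1 + IZR b1) / 2)
    (IZR (t - a1)) (IZR (t - a1)); try (rewrite minus_IZR; lra).
  - apply box_in_disk; rewrite ?minus_IZR in *; lra.
  - apply packs_row; [|simpl; lra].
    apply Forall_forall; intros r [<-|[<-|[]]]; rewrite minus_IZR; lra.
  - apply (range_below s0 empty (t - a1) c0 c1); auto; lra.
Qed.

(** Let [S = a^2 + b^2]. Then [p^2 + q^2 = 2 * 640000 - S / 4 >= S] is exactly [S <= 1024000], and
    together with [a * b <= p * q] this gives the claim after squaring. Equality occurs for two
    equal squares of the critical area. *)
Lemma stack_fits a b : 0 <= b <= a -> a * a + b * b <= 1024000 ->
  a + b <= sqrt (640000 - a * a / 4) + sqrt (640000 - b * b / 4).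
Proof.
  intros Hb Hs.
  pose proof (sqrt_sqrt (640000 - a * a / 4) ltac:(nra)) as Hp.
  pose proof (sqrt_sqrt (640000 - b * b / 4) ltac:(nra)) as Hq.
  pose proof (sqrt_pos (640000 - a * a / 4)) as Hp0.
  pose proof (sqrt_pos (640000 - b * b / 4)) as Hq0.
  set (p := sqrt (640000 - a * a / 4)) in *; set (q := sqrt (640000 - b * b / 4)) in *.
  assert (Hpq : a * b <= p * q).
  { apply Rsqr_incr_0_var; [unfold Rsqr|nra].
    replace (p * q * (p * q)) with ((p * p) * (q * q)) by ring; rewrite Hp, Hq.
    set (S := a * a + b * b) in *.
    assert (H4 : (a * b) * (a * b) * 4 <= S * S).
    { unfold S; pose proof (Rle_0_sqr (a * a - b * b)); unfold Rsqr in *; lra. }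
    (* With [4 (a b)^2 <= S^2 <= 1024000 S], the difference [(p q)^2 - (a b)^2] is at least
       [640000^2 - 400000 S >= 0]. *)
    assert (0 <= (1024000 - S) * S) by (apply Rmult_le_pos; [lra|unfold S; nra]).
    assert (E : (640000 - a * a / 4) * (640000 - b * b / 4)
      = 640000 * 640000 - 160000 * S + (a * b) * (a * b) / 16) by (unfold S; field).
    rewrite E; lra. }
  apply Rsqr_incr_0_var; unfold Rsqr; nra.
Qed.

(** The larger square is pushed up until its upper corners touch the circle, at height [p]; by
    [stack_fits] the smaller one below it ends at height [-q] or above. *)
Lemma packs_stack a b : 0 < b <= a -> a * a + b * b <= 1024000 ->
  packs (fun x y => disk x y /\ - a / 2 <= x <= a / 2) [b; a].
Proof.
  intros Hb Hs; pose proof (stack_fits a b ltac:(lra) Hs) as Hst.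
  pose proof (sqrt_sqrt (640000 - a * a / 4) ltac:(nra)) as Hp.
  pose proof (sqrt_sqrt (640000 - b * b / 4) ltac:(nra)) as Hq.
  pose proof (sqrt_pos (640000 - a * a / 4)) as Hp0.
  pose proof (sqrt_pos (640000 - b * b / 4)) as Hq0.
  set (p := sqrt (640000 - a * a / 4)) in *; set (q := sqrt (640000 - b * b / 4)) in *.
  assert (Hpq : p <= q) by (apply Rsqr_incr_0_var; unfold Rsqr; nra).
  assert (Hap : a <= 2 * p) by (apply Rsqr_incr_0_var; unfold Rsqr; nra).
  assert (Hsq : forall y r, - r <= y <= r -> y * y <= r * r).
  { intros y r Hy; assert (0 <= (r - y) * (r + y)) by (apply Rmult_le_pos; lra); lra. }
  pose proof (Hsq (p - a) p ltac:(lra)).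
  pose proof (Hsq (p - a) q ltac:(lra)).
  pose proof (Hsq (p - a - b) q ltac:(lra)).
  apply (packs_above (box (- b / 2) (b / 2) (p - a - b) (p - a)) (box (- a / 2) (a / 2) (p - a) p)
    _ (p - a) [b] [a]); try (unfold box; intros; lra).
  - intros x y Hxy; split; [|destruct Hxy; lra].
    revert Hxy; apply box_in_disk; lra.
  - intros x y Hxy; split; [|destruct Hxy; lra].
    revert Hxy; apply box_in_disk; lra.
  - apply packs_box_single; lra.
  - apply packs_box_single; lra.
Qed.

Lemma packs_two a b : 0 < b <= a -> a * a + b * b <= 1024000 -> packs disk [a; b].
Proof.
  intros Hb Hs; apply packs_perm with [b; a]; [apply perm_swap|].
  generalize (packs_stack a b Hb Hs); apply packs_incl; tauto.
Qed.

Lemma try_stack_spec s0 A a1 b0 c0 c1 a b c l : solver_ok s0 empty ->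
  0 < a <= IZR a1 -> (0 <= b0)%Z -> IZR b0 < b -> (0 <= c0)%Z -> IZR c0 < c <= IZR c1 ->
  descending (a :: b :: c :: l) -> total_area (b :: c :: l) <= IZR A ->
  total_area (a :: b :: c :: l) <= 1024000 ->
  try_stack s0 A a1 b0 c0 c1 = true -> packs disk (a :: b :: c :: l).
Proof.
  intros H0 Ha Hb0 Hb Hc0 Hc Hd Har Htot Ht; unfold try_stack in Ht.
  set (t := (- a1 / 2)%Z) in *.
  destruct (Z.leb_spec c1 (wide (t - c1) t)) as [Hw|]; [|discriminate].
  apply Z.ltb_lt, IZR_lt in Ht; rewrite !plus_IZR, !mult_IZR in Ht.
  destruct (descending_cons _ _ Hd) as (_ & Hle & Hd').
  destruct (descending_cons _ _ Hd') as (Hpos & _ & Hd'').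
  destruct (descending_cons _ _ Hd'') as (Hposc & Hlec & Hdl).
  assert (Hba : b <= a) by now inversion Hle.
  assert (Hb0' : 0 <= IZR b0) by now apply IZR_le.
  assert (Hc0' : 0 <= IZR c0) by now apply IZR_le.
  assert (Hbb : IZR b0 * IZR b0 <= b * b) by (apply Rmult_le_compat; lra).
  assert (Hcc : IZR c0 * IZR c0 <= c * c) by (apply Rmult_le_compat; lra).
  assert (Hta : IZR t <= - a / 2).
  { assert (H : (2 * t <= - a1)%Z) by (unfold t; apply Z.mul_div_le; lia).
    apply IZR_le in H; rewrite mult_IZR, opp_IZR in H; lra. }
  change (total_area (a :: b :: c :: l)) with (a * a + (b * b + (c * c + total_area l))) in Htot.
  change (total_area (b :: c :: l)) with (b * b + (c * c + total_area l)) in Har.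
  pose proof (total_area_nonneg l) as Hl0.
  assert (Hc1 : (0 < c1)%Z) by (apply lt_IZR; lra).
  set (W := wide (t - c1) t) in *.
  assert (HwR : IZR c1 <= IZR W) by now apply IZR_le.
  unfold next in Ht; rewrite mult_IZR in Ht.
  destruct (row_min_fill (res s0) empty (t / 4) (solver_row s0 (t / 4)) ((W - c1) / 4) (up4 c1) l
    (IZR W - c)) as (l1 & l2 & -> & Hs & Hl2); auto; try lra.
  { apply H0. }
  { now apply solver_row_good. }
  { revert Hlec; apply Forall_impl; intros; pose proof (up4_ge c1); lra. }
  { pose proof (div4_le (W - c1)) as H; rewrite minus_IZR in H; lra. }
  apply (below_mono _ _ (IZR t) _ _ (div4_le t)), packs_below_empty in Hl2.
  assert (Hl1 : packs (fun x y => disk x y /\ y <= IZR t) (c :: l1)).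
  { destruct (wide_spec (t - c1) t) as [Hw1 Hw2]; [fold W; lia|]; fold W in Hw1, Hw2.
    rewrite minus_IZR in Hw1.
    apply packs_incl with (box (- IZR W / 2) (IZR W / 2) (IZR t - IZR c1) (IZR t)).
    - intros x y Hxy; split; [|destruct Hxy; lra]; revert Hxy; apply box_in_disk; lra.
    - apply packs_row; [|simpl; lra].
      constructor; [lra|]; destruct Hdl as [Hp _].
      apply Forall_app in Hp; destruct Hp as [Hp _]; apply Forall_app in Hlec.
      destruct Hlec as [Hlec _]; rewrite Forall_forall in *; intros r Hr.
      specialize (Hp r Hr); specialize (Hlec r Hr); lra. }
  (* By symmetry of the disk, the single row is moved to the right of the stack and the remaining
     rows to its left. *)
  assert (Hright : packs (fun x y => disk x y /\ - x <= IZR t) (c :: l1)).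
  { apply packs_transpose, packs_reflect in Hl1; revert Hl1; apply packs_incl.
    unfold disk; intros x y H; lra. }
  assert (Hleft : packs (fun x y => disk x y /\ x <= IZR t) l2).
  { apply packs_transpose in Hl2; revert Hl2; apply packs_incl.
    unfold disk; intros x y H; lra. }
  apply packs_perm with (l2 ++ [b; a] ++ c :: l1).
  { rewrite Permutation_app_comm; simpl; rewrite perm_swap; now apply Permutation_refl. }
  apply (packs_beside (fun x y => disk x y /\ x <= IZR t) (fun x y => disk x y /\ IZR t <= x)
    _ (IZR t)); try tauto.
  apply (packs_beside (fun x y => disk x y /\ - a / 2 <= x <= a / 2)
    (fun x y => disk x y /\ - x <= IZR t) _ (a / 2)); auto.
  - tauto.
  - intros x y [_ H]; lra.
  - intros x y [? H]; split; auto; lra.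
  - intros x y [? H]; split; auto; lra.
  - apply packs_stack; [lra|nra].
Qed.

Lemma lazy_or_true (x y : bool) : (if x then true else y) = true -> x = true \/ y = true.
Proof. destruct x; auto. Qed.

Lemma lazy_and_true (x y : bool) : (if x then y else false) = true -> x = true /\ y = true.
Proof. destruct x; auto; discriminate. Qed.

Lemma area_tail a0 a l : (0 <= a0)%Z -> IZR a0 < a -> total_area (a :: l) <= 1024000 ->
  total_area l <= IZR (1024000 - a0 * a0).
Proof.
  intros Ha0 Ha Har; change (total_area (a :: l)) with (a * a + total_area l) in Har.
  rewrite minus_IZR, mult_IZR; apply IZR_le in Ha0.
  assert (IZR a0 * IZR a0 <= a * a) by (apply Rmult_le_compat; lra); lra.
Qed.

Lemma settled3_spec s0 s1 a0 a1 b0 b1 c0 c1 : solver_ok s0 empty ->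
  (forall e t, solver_ok s1 (pocket_pair e t)) ->
  settled3 s0 s1 a0 a1 b0 b1 c0 c1 = true ->
  (0 <= a0)%Z -> (0 <= b0)%Z -> (0 <= c0)%Z ->
  forall a b c l, IZR a0 < a <= IZR a1 -> IZR b0 < b <= IZR b1 -> IZR c0 < c <= IZR c1 ->
  descending (a :: b :: c :: l) -> total_area (a :: b :: c :: l) <= 1024000 ->
  packs disk (a :: b :: c :: l).
Proof.
  intros H0 H1 Hs Ha0 Hb0 Hc0 a b c l Ha Hb Hc Hd Har.
  pose proof (area_tail a0 a _ Ha0 (proj1 Ha) Har) as HA.
  destruct (descending_cons _ _ Hd) as (Hapos & _ & Hd').
  destruct (descending_cons _ _ Hd') as (_ & Hle & _).
  assert (Hcb : c <= b) by now inversion Hle.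
  unfold settled3 in Hs; cbv zeta in Hs; set (A := (1024000 - a0 * a0)%Z) in *.
  apply lazy_or_true in Hs; destruct Hs as [Hs|Hs].
  1: apply lazy_or_true in Hs; destruct Hs as [Hs|Hs].
  1: apply lazy_or_true in Hs; destruct Hs as [Hs|Hs].
  1: apply lazy_or_true in Hs; destruct Hs as [Hs|Hs].
  - apply Z.leb_le, IZR_le in Hs; lra.
  - exfalso; apply Z.ltb_lt, IZR_lt in Hs; rewrite plus_IZR, !mult_IZR in Hs.
    change (total_area (b :: c :: l)) with (b * b + (c * c + total_area l)) in HA.
    pose proof (total_area_nonneg l); apply IZR_le in Hb0, Hc0.
    assert (IZR b0 * IZR b0 <= b * b) by (apply Rmult_le_compat; lra).
    assert (IZR c0 * IZR c0 <= c * c) by (apply Rmult_le_compat; lra).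
    lra.
  - apply (try_pair_spec s0 A a1 b0 b1 c0 c1); auto; lra.
  - apply (try_top3_spec s0 s1 A a1 b0 b1 c0 c1); auto; lra.
  - apply (try_stack_spec s0 A a1 b0 c0 c1); auto; lra.
Qed.

Lemma midpoint_bounds u v : (0 <= u -> u < v -> 0 <= (u + v) / 2)%Z.
Proof. intros; apply Z.div_pos; lia. Qed.

Lemma search3_spec s0 s1 : solver_ok s0 empty ->
  (forall e t, solver_ok s1 (pocket_pair e t)) ->
  forall n a0 a1 b0 b1 c0 c1, search3 s0 s1 n a0 a1 b0 b1 c0 c1 = true ->
  (0 <= a0)%Z -> (0 <= b0)%Z -> (0 <= c0)%Z ->
  forall a b c l, IZR a0 < a <= IZR a1 -> IZR b0 < b <= IZR b1 -> IZR c0 < c <= IZR c1 ->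
  descending (a :: b :: c :: l) -> total_area (a :: b :: c :: l) <= 1024000 ->
  packs disk (a :: b :: c :: l).
Proof.
  intros H0 H1 n; induction n as [|n IH]; intros a0 a1 b0 b1 c0 c1 Hs Ha0 Hb0 Hc0
    a b c l Ha Hb Hc Hd Har; cbn [search3] in Hs; apply lazy_or_true in Hs;
    (destruct Hs as [Hs|Hs]; [now apply (settled3_spec s0 s1 a0 a1 b0 b1 c0 c1)|]);
    [discriminate|].
  assert (a0 < a1)%Z by (apply lt_IZR; lra).
  assert (b0 < b1)%Z by (apply lt_IZR; lra).
  assert (c0 < c1)%Z by (apply lt_IZR; lra).
  destruct (if (b1 - b0 <=? c1 - c0)%Z then (a1 - a0 <=? c1 - c0)%Z else false);
    [|destruct (a1 - a0 <=? b1 - b0)%Z]; cbv zeta in Hs; apply lazy_and_true in Hs;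
    destruct Hs as [Hlow Hhigh].
  - destruct (Rle_dec c (IZR ((c0 + c1) / 2))).
    + apply (IH _ _ _ _ _ _ Hlow); auto; lra.
    + apply (IH _ _ _ _ _ _ Hhigh); auto using midpoint_bounds; lra.
  - destruct (Rle_dec b (IZR ((b0 + b1) / 2))).
    + apply (IH _ _ _ _ _ _ Hlow); auto; lra.
    + apply (IH _ _ _ _ _ _ Hhigh); auto using midpoint_bounds; lra.
  - destruct (Rle_dec a (IZR ((a0 + a1) / 2))).
    + apply (IH _ _ _ _ _ _ Hlow); auto; lra.
    + apply (IH _ _ _ _ _ _ Hhigh); auto using midpoint_bounds; lra.
Qed.

Lemma search2_spec s0 s1 : solver_ok s0 empty ->
  (forall e t, solver_ok s1 (pocket_pair e t)) ->
  forall n a0 a1 b0 b1, search2 s0 s1 n a0 a1 b0 b1 = true ->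
  (0 <= a0)%Z -> (0 <= b0)%Z ->
  forall a b l, IZR a0 < a <= IZR a1 -> IZR b0 < b <= IZR b1 ->
  descending (a :: b :: l) -> total_area (a :: b :: l) <= 1024000 -> packs disk (a :: b :: l).
Proof.
  intros H0 H1 n; induction n as [|n IH]; intros a0 a1 b0 b1 Hs Ha0 Hb0 a b l Ha Hb Hd Har;
    cbn [search2] in Hs; apply lazy_or_true in Hs; destruct (descending_cons _ _ Hd) as (Hapos & Hle & Hd');
    assert (Hba : b <= a) by (now inversion Hle);
    pose proof (area_tail a0 a _ Ha0 (proj1 Ha) Har) as HA;
    assert (Hb0R := IZR_le _ _ Hb0); assert (Hbb : IZR b0 * IZR b0 <= b * b)
      by (apply Rmult_le_compat; lra);
    assert (HA2 : b * b + total_area l <= IZR (1024000 - a0 * a0)) by exact HA;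
    pose proof (total_area_nonneg l) as Hl0.
  all: destruct Hs as [Hs|Hs];
    [unfold settled2 in Hs; cbv zeta in Hs; apply lazy_or_true in Hs; destruct Hs as [Hs|Hs];
     [apply lazy_or_true in Hs; destruct Hs as [Hs|Hs];
      [apply Z.leb_le, IZR_le in Hs; lra
      |apply Z.ltb_lt, IZR_lt in Hs; rewrite mult_IZR in Hs; lra]
     |apply (try_top2_spec s0 s1 (1024000 - a0 * a0) a1 b0 b1); auto; lra]|].
  - discriminate.
  - assert (a0 < a1)%Z by (apply lt_IZR; lra).
    assert (b0 < b1)%Z by (apply lt_IZR; lra).
    destruct (if (b1 - b0 <=? 16)%Z then (a1 - a0 <=? 16)%Z else false);
      [|destruct (a1 - a0 <=? b1 - b0)%Z; cbv zeta in Hs; apply lazy_and_true in Hs;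
        destruct Hs as [Hlow Hhigh]].
    (* Without a third square, [a] and [b] are simply stacked. *)
    + destruct l as [|c l]; [apply packs_two; simpl in Har; try lra; split; lra|].
      apply (search3_spec s0 s1 H0 H1 _ _ _ _ _ _ _ Hs); auto; try lia.
      destruct (descending_cons _ _ Hd') as (_ & Hle' & Hd'').
      assert (Hcb : c <= b) by now inversion Hle'.
      destruct (descending_cons _ _ Hd'') as (Hcpos & _).
      split; [lra|].
      (* The upper end for [c] holds because [c^2 <= X] once [a0^2] and [b0^2] are taken off the
         total area. *)
      set (X := (1024000 - a0 * a0 - b0 * b0)%Z) in *.
      destruct (Z.min_spec b1 (Z.sqrt X + 1)) as [[_ ->]|[_ ->]]; [lra|].
      change (total_area (c :: l)) with (c * c + total_area l) in HA2.
      pose proof (total_area_nonneg l).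
      assert (HX : c * c <= IZR X).
      { unfold X; rewrite minus_IZR, (mult_IZR b0); lra. }
      assert (HX0 : (0 <= X)%Z) by (apply le_IZR; nra).
      pose proof (Z.sqrt_spec X HX0) as [_ Hsq]; pose proof (Z.sqrt_nonneg X) as Hsq0.
      apply IZR_lt in Hsq; apply IZR_le in Hsq0; rewrite mult_IZR in Hsq; unfold Z.succ in Hsq.
      rewrite plus_IZR in *.
      apply Rnot_lt_le; intros Hlt; nra.
    + destruct (Rle_dec b (IZR ((b0 + b1) / 2))).
      * apply (IH _ _ _ _ Hlow); auto; lra.
      * apply (IH _ _ _ _ Hhigh); auto using midpoint_bounds; lra.
    + destruct (Rle_dec a (IZR ((a0 + a1) / 2))).
      * apply (IH _ _ _ _ Hlow); auto; lra.
      * apply (IH _ _ _ _ Hhigh); auto using midpoint_bounds; lra.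
Qed.

Lemma settled1_spec s0 : solver_ok s0 empty -> res s0 = plain ->
  forallb (fun i => settled1 s0 (Z.of_nat i + 1)) (seq 0 123) = true -> forall a l, a <= 492 -> descending (a :: l) -> total_area (a :: l) <= 1024000 ->
  packs disk (a :: l).
Proof.
  intros H0 Hres Hs a l Ha Hd Har.
  destruct (exists_cell a) as [i Hi]; [apply (descending_cons _ _ Hd)|].
  assert (Hi' : (Z.of_nat i < 123)%Z) by (apply lt_IZR; lra).
  assert (Hj' : settled1 s0 (Z.of_nat i + 1) = true).
  { refine (proj1 (forallb_forall _ _) Hs i _); apply in_seq; lia. }
  clear Hs; set (j := (Z.of_nat i + 1)%Z) in *.
  assert (Hj : (1 <= j)%Z) by (unfold j; lia).
  assert (HjR : IZR j = IZR (Z.of_nat i) + 1) by (unfold j; now rewrite plus_IZR).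
  assert (Hgoal : forall t v, cell_good (below disk empty t) j v -> (64000 <? v)%Z = true ->
    packs disk (a :: l)).
  { intros t v Hg Hv; apply Z.ltb_lt, IZR_lt in Hv.
    apply packs_incl with (fun x y => disk x y /\ y <= t); [tauto|].
    apply packs_below_empty, Hg; auto; rewrite ?HjR; lra. }
  pose proof reserve_ok_plain as Hp.
  clearbody j; unfold settled1 in Hj'; destruct (j <=? 56)%Z.
  - apply (Hgoal _ _ (smooth_good plain empty 120 j Hp Hj ltac:(lia)) Hj').
  - set (t := Z.sqrt (200 * 200 - j * j)) in Hj'; clearbody t; cbv zeta in Hj'.
    refine (Hgoal _ _ (rowwise_good plain empty t j _ Hp Hj _) Hj').
    rewrite <- Hres; now apply solver_row_good.
Qed.

Lemma packs_disk_of_search s0 s1 : solver_ok s0 empty -> res s0 = plain ->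
  (forall e t, solver_ok s1 (pocket_pair e t)) ->
  forallb (fun i => settled1 s0 (Z.of_nat i + 1)) (seq 0 123) = true ->
  search2 s0 s1 60 492 1516 0 1024 = true ->
  forall l, descending l -> total_area l <= 1024000 -> packs disk l.
Proof.
  intros H0 Hres H1 Hs1 Hs2 l Hd Har.
  destruct l as [|a l]; [apply packs_nil|].
  destruct (descending_cons _ _ Hd) as (Ha & Hle & Hd').
  destruct (Rle_dec a 492); [now apply (settled1_spec s0)|].
  destruct l as [|b l].
  (* A single square is centered in the disk. *)
  - simpl in Har; apply packs_incl with (box (- a / 2) (a / 2) (- a / 2) (a / 2)).
    + apply box_in_disk; nra.
    + apply packs_box_single; lra.
  - assert (Hba : b <= a) by now inversion Hle.
    destruct (descending_cons _ _ Hd') as (Hb & _).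
    (* As [1012^2 > 1024000], all sides lie in the starting box of the search, whose edges have
       length 1024 and so halve evenly. *)
    assert (Ha' : a <= 1012).
    { change (total_area (a :: b :: l)) with (a * a + (b * b + total_area l)) in Har.
      pose proof (total_area_nonneg l); nra. }
    apply (search2_spec s0 s1 H0 H1 _ _ _ _ _ Hs2); auto; try lia; lra.
Qed.

Lemma packs_disk l : descending l -> total_area l <= 1024000 -> packs disk l.
Proof.
  pose proof search_succeeds as Hs; cbv zeta in Hs; apply lazy_and_true in Hs.
  destruct Hs as [Hs1 Hs2]; revert l; refine (packs_disk_of_search _ _ _ _ _ Hs1 Hs2).
  - apply solver_ok_table, reserve_ok_plain.
  - reflexivity.
  - intros; apply solver_ok_table, reserve_ok_pockets.
Qed.

(** * Sorting, scaling and the theorem *)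

Lemma exists_descending l : Forall (fun s => 0 < s) l ->
  exists l', Permutation l l' /\ descending l'.
Proof.
  induction 1 as [|a l Ha Hl (l' & Hp & Hd)].
  - exists []; split; [auto|split; constructor].
  - enough (H : exists l1, Permutation (a :: l') l1 /\ descending l1).
    { destruct H as (l1 & Hp1 & Hd1); exists l1; split; auto.
      now rewrite Hp. }
    clear l Hl Hp; induction l' as [|b l' IH].
    + exists [a]; split; auto; split; repeat constructor; auto.
    + destruct (descending_cons _ _ Hd) as (Hb & Hle & Hd').
      destruct (Rle_dec b a) as [Hba|Hba].
      * exists (a :: b :: l'); split; auto; destruct Hd as [Hp Hs]; split; constructor; auto.
        constructor; auto; revert Hle; apply Forall_impl; intros; lra.
      * destruct (IH Hd') as (l1 & Hp1 & Hpos1 & Hs1).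
        exists (b :: l1); split; [rewrite perm_swap; now apply perm_skip|].
        split; constructor; auto.
        apply (Permutation_Forall Hp1); constructor; auto; lra.
Qed.

Lemma total_area_perm l l' : Permutation l l' -> total_area l = total_area l'.
Proof. induction 1; simpl; lra. Qed.

Lemma total_area_scale r l : total_area (map (Rmult r) l) = r * r * total_area l.
Proof. induction l; simpl; lra. Qed.

Theorem theorem1 :
  (forall l : list R, Forall (fun s => 0 < s) l ->
     total_area l <= 8 / 5 -> packable_in_unit_disk l) /\
  (forall A : R, 8 / 5 < A ->
     exists l : list R, Forall (fun s => 0 < s) l /\
       total_area l = A /\ ~ packable_in_unit_disk l).
Proof.
  split.
  (* Scaling by 800 turns the area [8/5] into 1024000. *)
  - intros l Hl Ha; apply (packable_of_packs 800); [lra|].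
    destruct (exists_descending (map (Rmult 800) l)) as (l' & Hp & Hd).
    { apply Forall_map; revert Hl; apply Forall_impl; intros; lra. }
    apply (packs_perm disk l'); [now symmetry|].
    apply packs_disk; auto.
    rewrite <- (total_area_perm _ _ Hp), total_area_scale; lra.
  (* Two equal squares, each of area [A / 2 > 4/5], would both contain the center in their
     interiors. *)
  - intros A HA; pose proof (sqrt_lt_R0 (A / 2) ltac:(lra)) as Hs.
    pose proof (sqrt_sqrt (A / 2) ltac:(lra)) as Hss.
    exists [sqrt (A / 2); sqrt (A / 2)]; repeat split.
    + repeat constructor; auto.
    + simpl; lra.
    + apply two_large_squares_not_packable; lra.
Qed.
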